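(* Let $(M^{4n},Q,\omega)$, $n>1$, be a quaternionic skew-Hermitian manifold and $\hat\pi:\hat M\to M$ its Swann bundle. The 2-form $\hat\omega=\hat\pi^*\omega$ is a basic differential form on $\hat M$ which is presymplectic. Its kernel $\ker\hat\omega=\{X\in\Gamma(T\hat M):\iota_X\hat\omega=0\}$ is the linear span $\langle Z_0,Z_1,Z_2,Z_3\rangle=\hat{\mathcal V}$ (i.e. it consists of the sections of the vertical distribution), which is an integrable distribution.
   Context: All manifolds are smooth and connected. An almost quaternionic structure on $M^{4n}$ is a rank-3 subbundle $Q\subset\mathrm{End}(TM)$ locally spanned by an admissible frame $I_1,I_2,I_3$ with $I_1^2=I_2^2=I_3^2=-\mathrm{Id}=I_1I_2I_3$. A scalar 2-form with respect to $Q$ is a non-degenerate 2-form $\omega$ with $\omega(I_aX,I_aY)=\omega(X,Y)$. $(M,Q,\omega)$ is a quaternionic skew-Hermitian manifold if there is a (necessarily unique) torsion-free connection $\nabla$ preserving $Q$ with $\nabla\omega=0$ (so $\omega$ is closed). Swann bundle: let $S\to M$ be the principal $\mathrm{SO}(3)$-bundle of admissible frames $(I_1,I_2,I_3)$ of $Q$ and $S_0=(\wedge^{4n}T^*M\setminus\{0\})/\mathbb{Z}_2$ the principal $\mathbb{R}_+$-bundle of volume forms up to sign. The Swann bundle is the fibre product $\hat M=S_0\times_MS$, a principal bundle over $M$ with group $\mathbb{R}_+\times\mathrm{SO}(3)\cong\mathbb{H}^\times/\mathbb{Z}_2$ and projection $\hat\pi$. $Z_0,Z_1,Z_2,Z_3$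 are the fundamental vector fields of the basis $e_0=1,e_1=i,e_2=j,e_3=k$ of the Lie algebra $\mathbb{H}=\mathbb{R}\oplus\mathfrak{sp}(1)$ of the structure group, and $\hat{\mathcal V}=\ker d\hat\pi$. A form is basic if it is horizontal (annihilated by contraction with vertical vectors) and invariant under the structure group; presymplectic means closed (of constant rank). *)

(* Defs.v *)
From HB Require Import structures.
From mathcomp Require Import all_boot all_order all_algebra.
From mathcomp Require Import all_classical all_reals all_analysis.

Set Implicit Arguments.
Unset Strict Implicit.
Unset Printing Implicit Defensive.

Import Order.TTheory GRing.Theory Num.Theory.
Import numFieldNormedType.Exports.

Local Open Scope classical_set_scope.
Local Open Scope ring_scope.

(* C^k on an open set [U] of a finite-dimensional space. *)
Fixpoint Ck_on (R : realType) (V W : normedModType R) (k : nat) (U : set V)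
    (f : V -> W) : Prop :=
  match k with
  | 0%N => forall x, U x -> {for x, continuous f}
  | k'.+1 => (forall x, U x -> differentiable f x) /\
             (forall v : V, Ck_on k' U (fun x => 'd f x v))
  end.

Definition smooth_on (R : realType) (V W : normedModType R) (U : set V)
    (f : V -> W) : Prop :=
  forall k, Ck_on k U f.

Record chart (R : realType) (T : topologicalType) (m : nat) := Chart {
  cdom : set T;
  cmap : T -> 'rV[R]_m;
  cinv : 'rV[R]_m -> T;
  open_cdom : open cdom;
  open_cimg : open (cmap @` cdom);
  cmapK : forall p, cdom p -> cinv (cmap p) = p;
  cmap_continuous : forall p, cdom p -> {for p, continuous cmap};
  cinv_continuous : forall y, (cmap @` cdom) y -> {for y, continuous cinv}
}.

(* The atlas is indexed by the points, [mchart p] being a chart around [p].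
   The tangent space at [p] is ['rV[R]_m], a tangent vector at [p] being given
   by its components in the preferred chart [mchart p]. *)
Record manifold (R : realType) (m : nat) := Manifold {
  mpoint :> topologicalType;
  mchart : mpoint -> chart R mpoint m;
  mchart_mem : forall p, cdom (mchart p) p;
  mchart_compat : forall p q,
    smooth_on (cmap (mchart p) @` (cdom (mchart p) `&` cdom (mchart q)))
              (cmap (mchart q) \o cinv (mchart p));
  mhausdorff : hausdorff_space mpoint;
  msecond_countable : second_countable (T := mpoint)
}.

Section Tensors.
Variables (R : realType) (m : nat) (M : manifold R m).
Implicit Types (p q c : M) (U : set M).

(* Row [i] is the coordinate vector field d/dx^i of the chart around [c], at the
   point [q], as an element of the tangent space at [q]. *)
Definition coord_frame c q : 'M[R]_m :=
  'J (cmap (mchart q) \o cinv (mchart c)) (cmap (mchart c) q).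

(* The inverse matrix: components in the chart around [c]. *)
Definition coord_coframe c q : 'M[R]_m :=
  'J (cmap (mchart c) \o cinv (mchart q)) (cmap (mchart q) q).

Definition chart_image c U : set 'rV[R]_m :=
  cmap (mchart c) @` (U `&` cdom (mchart c)).

Definition local_fun (f : M -> R) c (y : 'rV[R]_m) : R^o :=
  f (cinv (mchart c) y).

Definition local_field (X : M -> 'rV[R]_m) c (y : 'rV[R]_m) : 'rV[R]_m :=
  let q := cinv (mchart c) y in X q *m coord_coframe c q.

(* Here and below an endomorphism [A] of a tangent space acts by
   [v |-> v *m A], so composition is the reversed matrix product. *)
Definition local_endo (A : M -> 'M[R]_m) c (y : 'rV[R]_m) : 'M[R]_m :=
  let q := cinv (mchart c) y in coord_frame c q *m A q *m coord_coframe c q.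

Definition local_form2 (w : M -> 'M[R]_m) c (y : 'rV[R]_m) : 'M[R]_m :=
  let q := cinv (mchart c) y in
  coord_frame c q *m w q *m (coord_frame c q)^T.

Definition local_vol (mu : M -> 'M[R]_m -> R) c (y : 'rV[R]_m) : R^o :=
  let q := cinv (mchart c) y in mu q (coord_frame c q).

Definition smooth_fun U (f : M -> R) : Prop :=
  forall c, smooth_on (chart_image c U) (local_fun f c).

Definition smooth_field U (X : M -> 'rV[R]_m) : Prop :=
  forall c, smooth_on (chart_image c U) (local_field X c).

Definition smooth_endo U (A : M -> 'M[R]_m) : Prop :=
  forall c, smooth_on (chart_image c U) (local_endo A c).

Definition smooth_form2 U (w : M -> 'M[R]_m) : Prop :=
  forall c, smooth_on (chart_image c U) (local_form2 w c).

Definition smooth_vol U (mu : M -> 'M[R]_m -> R) : Prop :=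
  forall c, smooth_on (chart_image c U) (local_vol mu c).

Definition form2_eval (B : 'M[R]_m) (u v : 'rV[R]_m) : R :=
  (u *m B *m v^T) 0 0.

Definition is_form2 (w : M -> 'M[R]_m) : Prop :=
  smooth_form2 setT w /\
  forall p u v, form2_eval (w p) u v = - form2_eval (w p) v u.

Definition nondegenerate (w : M -> 'M[R]_m) : Prop :=
  forall p u, (forall v, form2_eval (w p) u v = 0) -> u = 0.

(* d w = 0, through (d w)_ijk = d_i w_jk + d_j w_ki + d_k w_ij. *)
Definition closed_form2 (w : M -> 'M[R]_m) : Prop :=
  forall c y i j k, chart_image c setT y ->
    let dw a b d := 'd (fun z => local_form2 w c z b d : R^o) y (delta_mx 0 a) in
    dw i j k + dw j k i + dw k i j = 0.

Definition presymplectic (w : M -> 'M[R]_m) : Prop :=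
  closed_form2 w /\ exists r, forall p, \rank (w p) = r.

Definition dir_deriv (f : M -> R) p (v : 'rV[R]_m) : R :=
  'd (local_fun f p) (cmap (mchart p) p) v.

(* In the chart around [p] the components of [X p], [Y p] are [X p], [Y p]. *)
Definition lie_bracket (X Y : M -> 'rV[R]_m) p : 'rV[R]_m :=
  'd (local_field Y p) (cmap (mchart p) p) (X p)
  - 'd (local_field X p) (cmap (mchart p) p) (Y p).

(* [nabla p v Y] is the covariant derivative at [p] of [Y], a vector field
   smooth near [p], along the tangent vector [v]. *)
Record is_connection (nabla : forall p, 'rV[R]_m -> (M -> 'rV[R]_m) -> 'rV[R]_m)
    : Prop := IsConnection {
  conn_linear : forall U p Y a u v, open U -> U p -> smooth_field U Y ->
    nabla p (a *: u + v) Y = a *: nabla p u Y + nabla p v Y;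
  conn_add : forall U p v Y Z, open U -> U p ->
    smooth_field U Y -> smooth_field U Z ->
    nabla p v (fun q => Y q + Z q) = nabla p v Y + nabla p v Z;
  conn_leibniz : forall U p v f Y, open U -> U p ->
    smooth_fun U f -> smooth_field U Y ->
    nabla p v (fun q => f q *: Y q) =
      dir_deriv f p v *: Y p + f p *: nabla p v Y;
  conn_smooth : forall U X Y, open U -> smooth_field U X -> smooth_field U Y ->
    smooth_field U (fun p => nabla p (X p) Y)
}.

Definition torsion_free
    (nabla : forall p, 'rV[R]_m -> (M -> 'rV[R]_m) -> 'rV[R]_m) : Prop :=
  forall U p X Y, open U -> U p -> smooth_field U X -> smooth_field U Y ->
    nabla p (X p) Y - nabla p (Y p) X = lie_bracket X Y p.

(* For a section [A] of [Q], the endomorphism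
   (nabla_v A) Y = nabla_v (A Y) - A (nabla_v Y) is in [Q]. *)
Definition preserves_bundle
    (nabla : forall p, 'rV[R]_m -> (M -> 'rV[R]_m) -> 'rV[R]_m)
    (Q : M -> {vspace 'M[R]_m}) : Prop :=
  forall U p (A : M -> 'M[R]_m) v, open U -> U p -> smooth_endo U A ->
    (forall q, U q -> A q \in Q q) ->
    exists2 B, B \in Q p &
      forall V Y, open V -> V p -> smooth_field V Y ->
        nabla p v (fun q => Y q *m A q) - nabla p v Y *m A p = Y p *m B.

Definition parallel_form2
    (nabla : forall p, 'rV[R]_m -> (M -> 'rV[R]_m) -> 'rV[R]_m)
    (w : M -> 'M[R]_m) : Prop :=
  forall U p v X Y, open U -> U p -> smooth_field U X -> smooth_field U Y ->
    dir_deriv (fun q => form2_eval (w q) (X q) (Y q)) p v =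
      form2_eval (w p) (nabla p v X) (Y p) + form2_eval (w p) (X p) (nabla p v Y).

(* I_1, I_2, I_3 are [I 0], [I 1], [I 2]; the last equation is
   I_1 o I_2 o I_3 = - Id. *)
Definition admissible (I : 'I_3 -> 'M[R]_m) : Prop :=
  (forall a, I a *m I a = - 1%:M) /\ I 2 *m I 1 *m I 0 = - 1%:M.

Definition admissible_frame (Qp : {vspace 'M[R]_m}) (I : 'I_3 -> 'M[R]_m) : Prop :=
  admissible I /\ forall a, I a \in Qp.

Definition local_admissible_frame (Q : M -> {vspace 'M[R]_m}) U
    (I : M -> 'I_3 -> 'M[R]_m) : Prop :=
  (forall a, smooth_endo U (fun p => I p a)) /\
  (forall p, U p -> admissible_frame (Q p) (I p)).

Definition almost_quaternionic (Q : M -> {vspace 'M[R]_m}) : Prop :=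
  (forall p, \dim (Q p) = 3) /\
  (forall p, exists U I, [/\ open U, U p, local_admissible_frame Q U I &
     forall q, U q -> Q q = <<[seq I q a | a : 'I_3]>>%VS]).

Definition scalar_form2 (Q : M -> {vspace 'M[R]_m}) (w : M -> 'M[R]_m) : Prop :=
  [/\ is_form2 w, nondegenerate w &
      forall p I a u v, admissible_frame (Q p) I ->
        form2_eval (w p) (u *m I a) (v *m I a) = form2_eval (w p) u v].

Definition quaternionic_skew_hermitian (Q : M -> {vspace 'M[R]_m})
    (w : M -> 'M[R]_m) : Prop :=
  [/\ almost_quaternionic Q, scalar_form2 Q w &
      exists nabla, [/\ is_connection nabla, torsion_free nabla,
        preserves_bundle nabla Q & parallel_form2 nabla w]].

(* [F], defined on the open set [W], is smooth as a map into [M]. *)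
Definition smooth_into k (W : set 'rV[R]_k) (F : 'rV[R]_k -> M) : Prop :=
  forall w, W w -> exists2 V : set 'rV[R]_k, open V /\ V w &
    (forall v, V v -> cdom (mchart (F w)) (F v)) /\
    smooth_on V (cmap (mchart (F w)) \o F).

Definition tangent_param k (F : 'rV[R]_k -> M) (w : 'rV[R]_k) : 'M[R]_(k, m) :=
  'J (cmap (mchart (F w)) \o F) w.

(* Through every point there is an (immersed) integral manifold. *)
Definition integrable_distribution (D : M -> set 'rV[R]_m) : Prop :=
  forall p, exists k (W : set 'rV[R]_k) (F : 'rV[R]_k -> M),
    [/\ open W, smooth_into W F, (F @` W) p,
        forall w, W w -> row_free (tangent_param F w) &
        forall w, W w -> D (F w) = [set u *m tangent_param F w | u in setT]].

Definition local_diffeo_at (F : 'rV[R]_m -> M) (w : 'rV[R]_m) : Prop :=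
  exists (W : set 'rV[R]_m) (g : 'rV[R]_m -> 'rV[R]_m),
    let f := cmap (mchart (F w)) \o F in
    [/\ open W /\ W w, forall v, W v -> cdom (mchart (F w)) (F v),
        smooth_on W f, open (f @` W) /\ smooth_on (f @` W) g &
        forall v, W v -> g (f v) = v].

End Tensors.

Section Maps.
Variables (R : realType) (k m : nat) (N : manifold R k) (M : manifold R m).

Definition tangent_map (h : N -> M) (x : N) : 'M[R]_(k, m) :=
  'J (cmap (mchart (h x)) \o h \o cinv (mchart x)) (cmap (mchart x) x).

Definition pullback_form2 (h : N -> M) (w : M -> 'M[R]_m) (x : N) : 'M[R]_k :=
  tangent_map h x *m w (h x) *m (tangent_map h x)^T.

Definition vertical (h : N -> M) (x : N) : set 'rV[R]_k :=
  [set v | v *m tangent_map h x = 0].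

End Maps.

Section Quaternions.
Variable R : realType.

(* The quaternion x_0 + x_1 i + x_2 j + x_3 k. *)
Definition qmul (x y : 'rV[R]_4) : 'rV[R]_4 :=
  let x_ i := x 0 (inord i) in let y_ i := y 0 (inord i) in
  \row_i [:: x_ 0%N * y_ 0%N - x_ 1%N * y_ 1%N - x_ 2%N * y_ 2%N - x_ 3%N * y_ 3%N;
             x_ 0%N * y_ 1%N + x_ 1%N * y_ 0%N + x_ 2%N * y_ 3%N - x_ 3%N * y_ 2%N;
             x_ 0%N * y_ 2%N - x_ 1%N * y_ 3%N + x_ 2%N * y_ 0%N + x_ 3%N * y_ 1%N;
             x_ 0%N * y_ 3%N + x_ 1%N * y_ 2%N - x_ 2%N * y_ 1%N + x_ 3%N * y_ 0%N]`_i.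

Definition qconj (x : 'rV[R]_4) : 'rV[R]_4 :=
  \row_i (if i == 0 then x 0 i else - x 0 i).

Definition qnorm (x : 'rV[R]_4) : R := Num.sqrt (\sum_i x 0 i ^+ 2).

(* e_0 = 1, e_1 = i, e_2 = j, e_3 = k. *)
Definition qbasis (a : 'I_4) : 'rV[R]_4 := delta_mx 0 a.

(* The rotation y |-> q y q^-1 of the imaginary quaternions: column [b] holds the
   components of the image of e_(b+1). *)
Definition qrot (q : 'rV[R]_4) : 'M[R]_3 :=
  \matrix_(a, b)
    (qmul (qmul q (qbasis (lift 0 b))) (qconj q) 0 (lift 0 a) / qnorm q ^+ 2).

End Quaternions.

Section VolumeForms.
Variables (R : realType) (m : nat).

(* A nonzero alternating [m]-linear form in the rows of the argument. *)
Definition is_volume_form (mu : 'M[R]_m -> R) : Prop :=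
  [/\ forall (A B C : 'M[R]_m) i b c,
        row i A = b *: row i B + c *: row i C ->
        row' i B = row' i A -> row' i C = row' i A ->
        mu A = b * mu B + c * mu C,
      forall (A : 'M[R]_m) i j, i != j -> row i A = row j A -> mu A = 0 &
      exists A, mu A != 0].

Definition up_to_sign (mu : 'M[R]_m -> R) : set ('M[R]_m -> R) :=
  [set mu; fun A => - mu A].

End VolumeForms.

Section SwannBundle.
Variables (R : realType) (m : nat) (M : manifold R m).

(* Base point, volume form up to sign, frame. *)
Definition swann_triple : Type :=
  (M * set ('M[R]_m -> R) * ('I_3 -> 'M[R]_m))%type.

(* The underlying set of the fibre product S_0 x_M S. *)
Definition swann_set (Q : M -> {vspace 'M[R]_m}) : set swann_triple :=
  [set t | (exists2 mu, is_volume_form mu & t.1.2 = up_to_sign mu) /\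
           admissible_frame (Q t.1.1) t.2].

(* The structure group R_+ x SO(3) is H^* / {1,-1} through
   q |-> (|q|, qrot q).  The factor R_+ multiplies the volume form; SO(3) acts on
   frames by (I A)_b = \sum_a A_ab I_a. *)
Definition swann_act (t : swann_triple) (q : 'rV[R]_4) : swann_triple :=
  (t.1.1, [set (fun A => qnorm q * mu A) | mu in t.1.2],
   fun b => \sum_a qrot q a b *: t.2 a).

Definition local_section (mu : M -> 'M[R]_m -> R) (I : M -> 'I_3 -> 'M[R]_m) (p : M)
    : swann_triple :=
  (p, up_to_sign (mu p), I p).

Variables (P : manifold R (m + 4)) (tau : P -> swann_triple).

Definition swann_proj (x : P) : M := (tau x).1.1.

(* The point of [P] with triple [t] ([x0] if there is none). *)
Definition swann_pt (x0 : P) (t : swann_triple) : P :=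
  xget x0 [set x | tau x = t].

Definition swann_ract (q : 'rV[R]_4) (x : P) : P :=
  swann_pt x (swann_act (tau x) q).

(* The map (p, q) |-> s(p) q, with [p] written in the chart around the projection
   of [x]. *)
Definition swann_trivialization (mu : M -> 'M[R]_m -> R)
    (I : M -> 'I_3 -> 'M[R]_m) (x : P) (w : 'rV[R]_(m + 4)) : P :=
  let p := cinv (mchart (swann_proj x)) (lsubmx w) in
  swann_pt x (swann_act (local_section mu I p) (rsubmx w)).

(* The manifold [P] is the Swann bundle, [tau] identifying its points with
   triples: for every smooth local section s = (mu up to sign, I) over an open
   set U, the map U x H^* -> P, (p, q) |-> s(p) q, which is the double covering
   U x H^* -> U x (R_+ x SO(3)) followed by the local trivialization given by s,
   is a local diffeomorphism.  As these maps cover [P], the condition determines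
   the topology and the smooth structure of [P] uniquely. *)
Definition is_swann_bundle (Q : M -> {vspace 'M[R]_m}) : Prop :=
  set_bij setT (swann_set Q) tau /\
  forall (x : P) U mu I q,
    open U -> U (swann_proj x) ->
    smooth_vol U mu -> (forall p, U p -> is_volume_form (mu p)) ->
    local_admissible_frame Q U I ->
    q != 0 -> tau x = swann_act (local_section mu I (swann_proj x)) q ->
    local_diffeo_at (swann_trivialization mu I x)
      (row_mx (cmap (mchart (swann_proj x)) (swann_proj x)) q).

(* Z_a at [x]: the differential at q = 1 of the orbit map q |-> x q, applied to
   e_a. *)
Definition fundamental_field (a : 'I_4) (x : P) : 'rV[R]_(m + 4) :=
  'd (fun q => cmap (mchart x) (swann_ract q x)) (qbasis R 0) (qbasis R a).

Definition horizontal_form2 (w : P -> 'M[R]_(m + 4)) : Prop :=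
  forall x v, vertical swann_proj x v -> forall u, form2_eval (w x) v u = 0.

Definition invariant_form2 (w : P -> 'M[R]_(m + 4)) : Prop :=
  forall q, q != 0 -> pullback_form2 (swann_ract q) w = w.

Definition basic_form2 (w : P -> 'M[R]_(m + 4)) : Prop :=
  [/\ is_form2 w, horizontal_form2 w & invariant_form2 w].

End SwannBundle.

Section Kernel.
Variables (R : realType) (m : nat) (M : manifold R m).

Definition form2_kernel (w : M -> 'M[R]_m) : set (M -> 'rV[R]_m) :=
  [set X | smooth_field setT X /\ forall p v, form2_eval (w p) (X p) v = 0].

Definition sections (D : M -> set 'rV[R]_m) : set (M -> 'rV[R]_m) :=
  [set X | smooth_field setT X /\ forall p, D p (X p)].

(* The span over the smooth functions. *)
Definition field_span k (Z : 'I_k -> M -> 'rV[R]_m) : set (M -> 'rV[R]_m) :=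
  [set X | exists2 f : 'I_k -> M -> R, forall a, smooth_fun setT (f a) &
           X = fun p => \sum_a f a p *: Z a p].

Definition distribution_span k (Z : 'I_k -> M -> 'rV[R]_m) (p : M)
    : set 'rV[R]_m :=
  [set v | exists f : 'I_k -> R, v = \sum_a f a *: Z a p].

End Kernel.

(* Main.v *)
From HB Require Import structures.
Require Import Defs.
From mathcomp Require Import all_boot all_order all_algebra.
From mathcomp Require Import all_classical all_reals all_analysis.
From mathcomp Require Import ring.

(* Write points of the Swann bundle near a fixed one as [s(p) q], with [s] a local
   section and [q] a nonzero quaternion.  In the coordinates [(p, q)] the projection
   is [(p, q) |-> p] and the field [Z_a] is [(0, q e_a)]; hence the [Z_a] form a
   frame of the vertical distribution, with coefficients obtained by multiplying
   with [q^-1], and the orbits [q |-> x q] are its integral manifolds.  A local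
   section through a given point is made by applying a constant rotation to a local
   admissible frame and transporting a volume form in a chart.
   The form [omega] is closed because it is parallel for a torsion-free connection,
   and pullback preserves closedness by the symmetry of second derivatives.  Since
   the projection is a submersion and [omega] is nondegenerate, the kernel of the
   pullback is the vertical distribution. *)

Set Implicit Arguments.
Unset Strict Implicit.
Unset Printing Implicit Defensive.

Import Order.TTheory GRing.Theory Num.Theory.
Import numFieldNormedType.Exports.

Local Open Scope classical_set_scope.
Local Open Scope ring_scope.

(** * Smooth functions between normed spaces *)

Section SmoothCalculus.
Variable R : realType.
Implicit Types (V W : normedModType R).

(** Tangent vectors are given by components in the preferred chart of their own base point, and that
    chart may jump from point to point. A tensor can thus not be differentiated as it stands: it is
    rewritten in a fixed chart through transition Jacobians, and much of the bookkeeping checks that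
    the preferred charts cancel. Moreover chart inverses and the point of the bundle with a given
    triple are total functions with arbitrary values off their domains, so maps are compared only
    near a point, and derivatives are carried over between maps that agree there. The bundle is
    known only through the local diffeomorphisms attached to smooth local sections, so sections
    through arbitrary points have to be produced. A frame at a point is written with constant
    coefficients in a local frame; these coefficients form imaginary quaternions obeying the
    relations of i, j, k, and the same coefficients give an admissible frame at all nearby points.
    Using quaternions as fibre coordinates in place of rotations turns the action into
    multiplication on the right, which is linear. *)

Lemma near_eq_differentiable V W (f g : V -> W) x : {near x, f =1 g} ->
  differentiable f x -> differentiable g x /\ 'd g x = 'd f x :> (V -> W).
Proof.
move=> fg df.
have cdf : continuous ('d f x) by exact: diff_continuous.
(* The first-order expansion of [f] at [x] is also one of [g]; by uniqueness its linear part is the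
   differential of [g]. *)
have E : g \o shift x = cst (g x) + 'd f x +o_ 0 id.
  apply/eqaddoP => e e0.
  have /eqaddoP /(_ e e0) := diff_locally df.
  move=> H; near=> y.
  have gfy : g (y + x) = f (y + x).
    apply/esym; near: y.
    by move: fg; rewrite (near_shift 0 x) /=; apply: filterS => z; rewrite subr0.
  have -> : (g \o shift x - (cst (g x) + 'd f x)) y =
            (f \o shift x - (cst (f x) + 'd f x)) y.
    by rewrite !fctE /= gfy (nbhs_singleton fg).
  by near: y.
have E2 := diff_unique cdf E.
split; last exact: E2.
by apply/diff_locallyP; rewrite E2; split; [exact: cdf|exact: E].
Unshelve. all: by end_near. Qed.

Lemma open_eq_near V W (U : set V) (f g : V -> W) x : open U -> U x ->
  (forall y, U y -> f y = g y) -> {near x, f =1 g}.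
Proof. by move=> oU Ux fg; apply: (filterS fg (open_nbhs_nbhs (conj oU Ux))). Qed.

Lemma continuous_near V W (f g : V -> W) x : {near x, f =1 g} ->
  {for x, continuous f} -> {for x, continuous g}.
Proof.
move=> fg cf; rewrite /prop_for /continuous_at -(nbhs_singleton fg).
by apply: cvg_trans cf; apply: near_eq_cvg; move: fg; apply: filterS => y.
Unshelve. all: by end_near. Qed.

Lemma Ck_on_ext V W k (U : set V) (f g : V -> W) : open U ->
  (forall x, U x -> f x = g x) -> Ck_on k U f -> Ck_on k U g.
Proof.
move=> oU; elim: k f g => [|k IH] f g fg /=.
  by move=> cf x Ux; apply: continuous_near (cf x Ux); exact: open_eq_near fg.
have H x : U x -> differentiable f x ->
    differentiable g x /\ 'd g x = 'd f x :> (V -> W).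
  by move=> Ux; apply: near_eq_differentiable; exact: open_eq_near fg.
move=> [df dfv]; split=> [x Ux|v]; first by case: (H x Ux (df x Ux)).
by apply: IH (dfv v) => x Ux; case: (H x Ux (df x Ux)) => _ ->.
Qed.

Lemma Ck_on_sub V W k (U U' : set V) (f : V -> W) : U' `<=` U ->
  Ck_on k U f -> Ck_on k U' f.
Proof.
move=> sU; elim: k f => [|k IH] f /= H; first by move=> x /sU /H.
by case: H => df dfv; split=> [x /sU /df//|v]; exact: IH.
Qed.

(** [Ck_on] asks a condition at each point of the set, about [f] as a function on the whole space.
    It can therefore be checked point by point, whether or not [D] is open. *)
Lemma Ck_on_local V W k (U : set V) (f : V -> W) :
  (forall x, U x -> exists2 D : set V, D x & Ck_on k D f) -> Ck_on k U f.
Proof.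
elim: k f => [|k IH] f H /=.
  by move=> x /H [D Dx] cO; exact: cO.
split=> [x /H [D Dx [df _]]|v]; first exact: df.
by apply: IH => x /H [D Dx [_ dfv]]; exists D => //; exact: dfv.
Qed.

Lemma Ck_onW V W k (U : set V) (f : V -> W) : Ck_on k.+1 U f -> Ck_on k U f.
Proof.
elim: k f => [|k IH] f /= [df dfv].
  by move=> x /df; exact: differentiable_continuous.
by split=> // v; exact: IH.
Qed.

Lemma Ck_on_cst V W k (U : set V) (a : W) : Ck_on k U (fun _ : V => a).
Proof.
elim: k a => [|k IH] a /=; first by move=> x _; exact: cvg_cst.
split=> [x _|v]; first exact: differentiable_cst.
have -> : (fun x => 'd (fun _ : V => a) x v) = (fun=> 0) by
  apply/funext => x; rewrite (diff_cst a x).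
exact: IH.
Qed.

Lemma Ck_onD V W k (U : set V) (f g : V -> W) : open U ->
  Ck_on k U f -> Ck_on k U g -> Ck_on k U (fun x => f x + g x).
Proof.
move=> oU; elim: k f g => [|k IH] f g /=.
  by move=> cf cg x Ux; apply: continuousD; [exact: cf|exact: cg].
move=> [df dfv] [dg dgv]; split=> [x Ux|v].
  by apply: differentiableD; [exact: df|exact: dg].
apply: (Ck_on_ext oU) (IH _ _ (dfv v) (dgv v)) => x Ux.
exact/esym/(congr1 (fun h : V -> W => h v) (diffD (df _ Ux) (dg _ Ux))).
Qed.

Lemma Ck_on_linear V W W' k (U : set V) (L : {linear W -> W'}) (f : V -> W) :
  open U -> continuous L -> Ck_on k U f -> Ck_on k U (fun x => L (f x)).
Proof.
move=> oU cL; elim: k f => [|k IH] f /=.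
  by move=> cf x Ux; apply: continuous_comp; [exact: cf|exact: cL].
move=> [df dfv]; split=> [x Ux|v].
  by apply: differentiable_comp; [exact: df|exact: linear_differentiable].
apply: (Ck_on_ext oU) (IH _ (dfv v)) => x Ux.
rewrite (diff_comp (df _ Ux) (linear_differentiable _ cL)) /=.
by rewrite (diff_lin _ cL).
Qed.

Lemma scale_is_bilinear W : bilinear_for
    (GRing.Scale.Law.clone _ _ *:%R _) (GRing.Scale.Law.clone _ _ *:%R _)
    (fun (a : R^o) (w : W) => a *: w).
Proof.
split=> [u'|u] a x y /=; first by rewrite scalerDl scalerA.
by rewrite scalerDr !scalerA mulrC.
Qed.

Lemma is_diff_scale V W (f : V -> R^o) (g : V -> W) x :
  differentiable f x -> differentiable g x ->
  differentiable (fun y => f y *: g y) x /\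
  'd (fun y => f y *: g y) x = (fun v => f x *: 'd g x v + 'd f x v *: g x)
    :> (V -> W).
Proof.
move=> df dg.
pose bM := bilinear_isBilinear.Build R R^o W W _ _
  (fun (a : R^o) (w : W) => a *: w) (@scale_is_bilinear W).
pose b : {bilinear R^o -> W -> W} :=
  HB.pack (fun (a : R^o) (w : W) => a *: w) bM.
have cb : continuous (fun p : R^o * W => b p.1 p.2).
  by move=> p; exact: scale_continuous.
have -> : (fun y => f y *: g y) = (fun p : R^o * W => b p.1 p.2) \o (fun y => (f y, g y)).
  by [].
have dp := differentiable_pair df dg.
have dB := differentiable_bilin (f x, g x) cb.
split; first exact: differentiable_comp.
by rewrite (diff_comp dp dB) (diff_bilin _ cb) (diff_pair df dg).
Qed.

Lemma Ck_onZ V W k (U : set V) (f : V -> R^o) (g : V -> W) : open U ->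
  Ck_on k U f -> Ck_on k U g -> Ck_on k U (fun x => f x *: g x).
Proof.
move=> oU; elim: k f g => [|k IH] f g /=.
  by move=> cf cg x Ux; apply: cvgZ; [exact: cf|exact: cg].
move=> [df dfv] [dg dgv]; split=> [x Ux|v].
  by have [] := is_diff_scale (df x Ux) (dg x Ux).
apply: (Ck_on_ext oU (f := fun x => f x *: 'd g x v + 'd f x v *: g x)).
  by move=> x Ux; rewrite (is_diff_scale (df x Ux) (dg x Ux)).2.
by apply: Ck_onD => //; apply: IH => //; exact: Ck_onW.
Qed.

Lemma Ck_on_sum V W k (U : set V) (I : Type) (r : seq I) (P : pred I)
    (f : I -> V -> W) : open U ->
  (forall i, P i -> Ck_on k U (f i)) -> Ck_on k U (fun x => \sum_(i <- r | P i) f i x).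
Proof.
move=> oU H; elim: r => [|i r IH].
  by under eq_fun do rewrite big_nil; exact: Ck_on_cst.
under eq_fun do rewrite big_cons.
by case: (boolP (P i)) => Pi //; apply: Ck_onD => //; exact: H.
Qed.

(** The derivative of 1/f is -f'/f^2, and its factors 1/f are C^k by induction. *)
Lemma Ck_onV V k (U : set V) (f : V -> R^o) : open U ->
  (forall x, U x -> f x != 0) -> Ck_on k U f -> Ck_on k U (fun x => (f x)^-1 : R^o).
Proof.
move=> oU f0; elim: k => [|k IH].
  by move=> cf x Ux; apply: cvgV; [exact: f0|exact: cf].
move=> Cf; have IHf := IH (Ck_onW Cf); case: Cf => df dfv; split=> [x Ux|v].
  by apply: differentiableV; [exact: df|exact: f0].
apply: (Ck_on_ext oU (f := fun x => (f x)^-1 *: ((f x)^-1 *: ((-1) *: 'd f x v)) : R^o)).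
  move=> x Ux; apply: etrans (esym (congr1 (fun h : V -> R => h v)
    (diffV (df _ Ux) (f0 _ Ux)))).
  by rewrite scaleN1r !scalerN scalerA -invfM -expr2 -scaleNr.
apply: Ck_onZ => //; apply: Ck_onZ => //; apply: Ck_onZ => //; last exact: dfv.
exact: (@Ck_on_cst V R^o).
Qed.

(** In finite dimension [L] is a sum of coordinate functions times fixed vectors, and coordinates
    are continuous. *)
Lemma matrix_linear_continuous m n W (L : {linear 'M[R]_(m, n) -> W}) : continuous L.
Proof.
have -> : (L : 'M[R]_(m, n) -> W) =
    fun B => \sum_i \sum_j B i j *: L (delta_mx i j).
  apply/funext => B; rewrite {1}[B]matrix_sum_delta linear_sum.
  apply: eq_bigr => i _; rewrite linear_sum.
  by apply: eq_bigr => j _; rewrite linearZ.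
suff H : Ck_on 0 [set: 'M[R]_(m, n)]
    (fun B => \sum_i \sum_j B i j *: L (delta_mx i j)) by move=> A; exact: H.
apply: Ck_on_sum => [|i _]; first exact: openT.
apply: Ck_on_sum => [|j _]; first exact: openT.
apply: (Ck_onZ (f := fun B : 'M[R]_(m, n) => B i j : R^o)); first exact: openT.
  by move=> B _; exact: coord_continuous.
exact: Ck_on_cst.
Qed.

Lemma Ck_on_mlinear m n V W k (U : set V) (L : {linear 'M[R]_(m, n) -> W})
    (f : V -> 'M[R]_(m, n)) :
  open U -> Ck_on k U f -> Ck_on k U (fun x => L (f x)).
Proof. by move=> oU; apply: Ck_on_linear => //; exact: matrix_linear_continuous. Qed.

Lemma coord_is_linear m n i j : linear (fun A : 'M[R]_(m, n) => A i j : R^o).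
Proof. by move=> a A B; rewrite !mxE. Qed.

Lemma Ck_on_coord m n V k (U : set V) (f : V -> 'M[R]_(m, n)) i j : open U ->
  Ck_on k U f -> Ck_on k U (fun x => f x i j : R^o).
Proof.
move=> oU Cf.
pose LM := GRing.isLinear.Build _ _ _ _ _ (@coord_is_linear m n i j).
pose L : {linear 'M[R]_(m, n) -> R^o} := HB.pack (fun A : 'M[R]_(m, n) => A i j : R^o) LM.
exact: (Ck_on_mlinear L oU Cf).
Qed.

Lemma Ck_on_matrix m n V k (U : set V) (f : V -> 'M[R]_(m, n)) : open U ->
  (forall i j, Ck_on k U (fun x => f x i j : R^o)) -> Ck_on k U f.
Proof.
move=> oU H.
have -> : f = fun x => \sum_i \sum_j f x i j *: delta_mx i j.
  by apply/funext => x; exact: matrix_sum_delta.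
apply: Ck_on_sum => // i _; apply: Ck_on_sum => // j _.
by apply: (Ck_onZ (f := fun x => f x i j : R^o)) => //; exact: Ck_on_cst.
Qed.

Lemma Ck_on_mulmx m n p V k (U : set V) (f : V -> 'M[R]_(m, n))
    (g : V -> 'M[R]_(n, p)) : open U ->
  Ck_on k U f -> Ck_on k U g -> Ck_on k U (fun x => f x *m g x).
Proof.
move=> oU Cf Cg; apply: Ck_on_matrix => // i j.
under eq_fun do rewrite mxE.
apply: (@Ck_on_sum V R^o) => // l _.
by apply: (@Ck_onZ V R^o) => //; exact: Ck_on_coord.
Qed.

Lemma diff_row_sum m V (f : 'rV[R]_m -> V) y v :
  'd f y v = \sum_i v 0 i *: 'd f y (delta_mx 0 i).
Proof.
rewrite {1}[v]row_sum_delta linear_sum; apply: eq_bigr => i _.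
by rewrite linearZ.
Qed.

(** Expanding ['d f x v] on the standard basis turns the derivative of the composite into a sum of
    products: a coordinate of ['d f x v] times a partial derivative of [g] composed with [f], to
    which the induction applies. This is why [f] takes its values in a row space. *)
Lemma Ck_on_comp m V W k (U : set V) (U' : set 'rV[R]_m) (f : V -> 'rV[R]_m)
    (g : 'rV[R]_m -> W) : open U -> open U' -> (forall x, U x -> U' (f x)) ->
  Ck_on k U f -> Ck_on k U' g -> Ck_on k U (fun x => g (f x)).
Proof.
move=> oU oU' fU; elim: k g => [|k IH] g.
  by move=> cf cg x Ux; apply: continuous_comp; [exact: cf|exact/cg/fU].
move=> Cf; have Cf' := Ck_onW Cf; case: Cf => df dfv [dg dgv]; split=> [x Ux|v].
  by apply: differentiable_comp; [exact: df|exact/dg/fU].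
apply: (Ck_on_ext oU (f := fun x => \sum_i ('d f x v) 0 i *: 'd g (f x) (delta_mx 0 i))).
  move=> x Ux; rewrite -diff_row_sum.
  by rewrite (diff_comp (df _ Ux) (dg _ (fU _ Ux))).
apply: Ck_on_sum => // i _; apply: (Ck_onZ (f := fun x => 'd f x v 0 i : R^o)) => //.
  by apply: (Ck_on_coord (f := fun x => 'd f x v)) => //; exact: dfv.
exact: (IH _ Cf' (dgv _)).
Qed.

Lemma smooth_on_diff V W (U : set V) (f : V -> W) x :
  smooth_on U f -> U x -> differentiable f x.
Proof. by move=> /(_ 1%N)[df _]; exact: df. Qed.

Lemma smooth_on_diffv V W (U : set V) (f : V -> W) v :
  smooth_on U f -> smooth_on U (fun x => 'd f x v).
Proof. by move=> Cf k; have [_ H] := Cf k.+1; exact: H. Qed.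

Lemma smooth_on_continuous V W (U : set V) (f : V -> W) x :
  smooth_on U f -> U x -> {for x, continuous f}.
Proof. by move=> /(_ 0%N); exact. Qed.

Lemma smooth_on_id V (U : set V) : smooth_on U (id : V -> V).
Proof.
case=> [|k] /=; first by move=> x _; exact: cvg_id.
have dE (x : V) : differentiable (id : V -> V) x /\ 'd (id : V -> V) x = id :> (V -> V).
  by split; [exact: ex_diff|exact: diff_val].
split=> [x _|v]; first by case: (dE x).
have -> : (fun x => 'd (id : V -> V) x v) = (fun=> v).
  by apply/funext => x; case: (dE x) => _ ->.
exact: Ck_on_cst.
Qed.

Lemma jacobianE m n (f : 'rV[R]_m -> 'rV[R]_n) y v : v *m 'J f y = 'd f y v.
Proof. by rewrite mul_rV_lin1. Qed.

Lemma row_jacobian m n (f : 'rV[R]_m -> 'rV[R]_n) y i :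
  row i ('J f y) = 'd f y (delta_mx 0 i).
Proof. by rewrite rowE jacobianE. Qed.

Lemma smooth_on_jacobian m n (U : set 'rV[R]_m) (f : 'rV[R]_m -> 'rV[R]_n) :
  open U -> smooth_on U f -> smooth_on U (fun y => 'J f y).
Proof.
move=> oU Cf k; apply: Ck_on_matrix => // i j.
have -> : (fun x => 'J f x i j : R^o) = (fun x => ('d f x (delta_mx 0 i)) 0 j : R^o).
  by apply/funext => x; rewrite -row_jacobian [RHS]mxE.
by apply: Ck_on_coord => //; exact: smooth_on_diffv.
Qed.

Lemma jacobian_comp m n p (f : 'rV[R]_m -> 'rV[R]_n) (g : 'rV[R]_n -> 'rV[R]_p) y :
  differentiable f y -> differentiable g (f y) ->
  'J (g \o f) y = 'J f y *m 'J g (f y).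
Proof.
move=> df dg; apply/row_matrixP => i.
rewrite row_mul !row_jacobian jacobianE.
exact: (congr1 (fun h => h (delta_mx 0 i)) (diff_comp df dg)).
Qed.

Lemma jacobian_near m n (f g : 'rV[R]_m -> 'rV[R]_n) y : {near y, f =1 g} ->
  differentiable f y -> 'J f y = 'J g y.
Proof.
move=> fg df; apply/row_matrixP => i.
apply: etrans (row_jacobian f y i) _; apply: etrans (esym (row_jacobian g y i)).
by have [_ /(congr1 (fun h => h (delta_mx 0 i)))/esym] := near_eq_differentiable fg df.
Qed.

Lemma jacobian_id m (y : 'rV[R]_m) : 'J (id : 'rV[R]_m -> 'rV[R]_m) y = 1%:M.
Proof.
by apply/row_matrixP => i; rewrite row_jacobian row1 diff_val.
Qed.

Lemma jacobian_linear m n (L : {linear 'rV[R]_m -> 'rV[R]_n}) y :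
  'J L y = lin1_mx L.
Proof.
apply/row_matrixP => i; rewrite row_jacobian [RHS]rowE mul_rV_lin1.
by rewrite (diff_lin _ (@matrix_linear_continuous _ _ _ L)).
Qed.

Lemma is_derive_line V (f : V -> R^o) (a u : V) (s : R) :
  differentiable f (a + s *: u) ->
  is_derive (s : R^o) 1 (fun t : R^o => f (a + t *: u) : R^o) ('d f (a + s *: u) u).
Proof.
move=> df; pose l := fun t : R^o => a + t *: u.
have [dl El] : differentiable l s /\ 'd l s = (fun t => t *: u) :> (R^o -> V).
  have [d1 e1] := is_diff_scale (f := id : R^o -> R^o) (g := fun=> u) (x := s)
    ltac:(exact: ex_diff) (differentiable_cst _ _).
  have dc := differentiable_cst a (s : R^o).
  split; first exact: (differentiableD dc d1).
  apply/funext => t.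
  have Ea : 'd (cst a) (s : R^o) t = 0 :=
    congr1 (fun h : R^o -> V => h t) (diff_cst a (s : R^o)).
  have Eu : 'd (fun=> u) (s : R^o) t = 0 :=
    congr1 (fun h : R^o -> V => h t) (diff_cst u (s : R^o)).
  have Ei : 'd (id : R^o -> R^o) (s : R^o) t = t :=
    congr1 (fun h : R^o -> R^o => h t) (@diff_val _ _ _ _ _ _ _ (is_diff_id (s : R^o))).
  have E1 := congr1 (fun h : R^o -> V => h t) e1.
  apply: etrans (congr1 (fun h : R^o -> V => h t) (diffD dc d1)) _.
  apply: etrans (congr2 +%R Ea E1) _.
  by rewrite add0r Eu Ei scaler0 add0r.
have dfl := differentiable_comp dl df.
apply: DeriveDef; first exact: diff_derivable.
rewrite (deriveE _ dfl).
have -> := congr1 (fun h : R^o -> R^o => h 1) (diff_comp dl df).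
by rewrite /= El scale1r.
Qed.

(** The mean value theorem is used twice: along [u] for the difference of [f] on two parallel sides
    of the parallelogram, then along [v] for the derivative so obtained. *)
Lemma second_difference V (U : set V) (f : V -> R^o) (x u v : V) (h : R) :
  Ck_on 2 U f -> 0 < h ->
  (forall s t, s \in `[0, h] -> t \in `[0, h] -> U (x + s *: u + t *: v)) ->
  exists s t, [/\ s \in `[0, h], t \in `[0, h] &
    (f (x + h *: u + h *: v) - f (x + h *: u)) - (f (x + h *: v) - f x) =
    h * h * 'd (fun z => 'd f z u : R^o) (x + s *: u + t *: v) v].
Proof.
move=> [df d2f] h0 Ust; have [ddf _] := d2f u.
have i0 : 0 \in `[0, h] by rewrite in_itv /= lexx ltW.
have ih : h \in `[0, h] by rewrite in_itv /= lexx ltW.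
have D1 s : s \in `[0, h] -> is_derive (s : R^o) 1
    (fun s : R^o => f (x + h *: v + s *: u) - f (x + s *: u) : R^o)
    ('d f (x + h *: v + s *: u) u - 'd f (x + s *: u) u).
  move=> si; apply: is_deriveB; apply: is_derive_line; apply: df.
    by rewrite addrAC; exact: Ust.
  by have := Ust _ _ si i0; rewrite scale0r addr0.
have subI (s : R) : s \in `]0, h[ -> s \in `[0, h].
  by rewrite !in_itv /= => /andP[/ltW -> /ltW ->].
have [s si E1] := MVT_segment (ltW h0) (fun s si => D1 s (subI s si))
  (derivable_within_continuous (fun s si => @ex_derive _ _ _ _ _ _ _ (D1 s si))).
have D2 t : t \in `[0, h] -> is_derive (t : R^o) 1
    (fun t : R^o => 'd f (x + s *: u + t *: v) u : R^o)
    ('d (fun z => 'd f z u : R^o) (x + s *: u + t *: v) v).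
  by move=> ti; apply: (is_derive_line (f := fun z => 'd f z u)); apply: ddf; exact: Ust.
have [t ti E2] := MVT_segment (ltW h0) (fun s si => D2 s (subI s si))
  (derivable_within_continuous (fun s si => @ex_derive _ _ _ _ _ _ _ (D2 s si))).
exists s, t; split=> //.
move: E1 E2; rewrite !scale0r !addr0 !subr0 => E1 E2.
rewrite [x + h *: u + h *: v]addrAC E1 [x + h *: v + s *: u]addrAC E2.
by rewrite -mulrA mulrC.
Qed.

(** The second difference over a parallelogram is symmetric in [u] and [v]. Hence the two mixed
    derivatives take a common value at points of an arbitrarily small parallelogram, and continuity
    at [x] forbids that they differ there. *)
Lemma diff2_sym V (U : set V) (f : V -> R^o) (x u v : V) :
  open U -> U x -> Ck_on 2 U f ->
  'd (fun z => 'd f z u : R^o) x v = 'd (fun z => 'd f z v : R^o) x u.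
Proof.
move=> oU Ux Cf; have [_ d2f] := Cf.
pose A z := 'd (fun z => 'd f z u : R^o) z v : R^o.
pose B z := 'd (fun z => 'd f z v : R^o) z u : R^o.
have cA : {for x, continuous A} by have [_ /(_ v)] := d2f u; exact.
have cB : {for x, continuous B} by have [_ /(_ u)] := d2f v; exact.
apply/eqP; apply: contraT => AB; rewrite -/(A x) -/(B x) in AB *.
have e0 : 0 < `|A x - B x| / 2 by rewrite divr_gt0 ?normr_gt0 ?subr_eq0.
have nA : \forall t \near nbhs x, `|A x - A t| < `|A x - B x| / 2.
  by move/cvgrPdist_lt : cA; exact.
have nB : \forall t \near nbhs x, `|B x - B t| < `|A x - B x| / 2.
  by move/cvgrPdist_lt : cB; exact.
have nU : nbhs x U by exact: open_nbhs_nbhs.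
have [d /= d0 Hd] := (nbhs_ballP _ _).1 (filterI nU (filterI nA nB)).
(* With side factor [d / c] the parallelogram stays in the ball of radius [d]; the added 1 keeps [c]
   positive when [u] and [v] vanish. *)
pose c := `|u| + `|v| + 1.
have c0 : 0 < c by rewrite /c ltr_wpDl // addr_ge0.
pose h := d / c.
have h0 : 0 < h by rewrite divr_gt0.
have Hst s t : s \in `[0, h] -> t \in `[0, h] -> ball x d (x + s *: u + t *: v).
  rewrite !in_itv /= => /andP[s0 sh] /andP[t0 th].
  rewrite -ball_normE /= -addrA opprD addrA subrr sub0r normrN.
  apply: le_lt_trans (ler_normD _ _) _; rewrite !normrZ !ger0_norm //.
  apply: (@le_lt_trans _ _ (h * (`|u| + `|v|))).
    by rewrite mulrDr lerD // ler_wpM2r.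
  rewrite /h -mulrA gtr_pMr // ltr_pdivrMl // mulr1 /c.
  by rewrite ltrDl.
have [s [t [si ti E1]]] := second_difference (u := u) (v := v) Cf h0
  (fun s t si ti => (Hd _ (Hst s t si ti)).1).
have Hst' s' t' : s' \in `[0, h] -> t' \in `[0, h] -> ball x d (x + s' *: v + t' *: u).
  by move=> si' ti'; rewrite addrAC; exact: Hst.
have [s' [t' [si' ti' E2]]] := second_difference (u := v) (v := u) Cf h0
  (fun s t si ti => (Hd _ (Hst' s t si ti)).1).
have AB' : A (x + s *: u + t *: v) = B (x + s' *: v + t' *: u).
  apply: (mulfI (x := h * h)); first by rewrite mulf_neq0 ?gt_eqF.
  rewrite -E1 -E2 [x + h *: v + h *: u]addrAC.
  by rewrite !opprD !opprK addrACA.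
have [_ [a1 _]] := Hd _ (Hst s t si ti).
have [_ [_ b1]] := Hd _ (Hst' s' t' si' ti').
rewrite /= AB' in a1; rewrite /= in b1.
have : `|A x - B x| < `|A x - B x|.
  rewrite {2}[`|A x - B x|]splitr.
  apply: le_lt_trans (ltrD a1 b1).
  rewrite [X in _ <= _ + X]distrC.
  by apply: le_trans (ler_normD _ _); rewrite addrA subrK.
by rewrite ltxx.
Qed.

End SmoothCalculus.

(** * Charts and smooth mappings *)

Lemma open_preimage_on (S T : topologicalType) (U : set S) (f : S -> T) (D : set T) :
  open U -> (forall x, U x -> {for x, continuous f}) -> open D ->
  open (U `&` f @^-1` D).
Proof.
move=> oU cf oD; rewrite openE => x [Ux Dfx].
apply: filterI; first exact: open_nbhs_nbhs.
by apply: cf => //; exact: open_nbhs_nbhs.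
Qed.

Lemma mulmx_insert (R : pzRingType) m n p (x : 'M[R]_(m, n)) (C : 'M[R]_(n, p))
    (A F : 'M[R]_n) : A *m F = 1%:M -> x *m C = x *m A *m (F *m C).
Proof. by move=> AF; rewrite mulmxA -(mulmxA x) AF mulmx1. Qed.

Section ChartChanges.
Variables (R : realType) (m : nat) (M : manifold R m).
Implicit Types (p q c : M) (U : set M).

Definition trans c c' : 'rV[R]_m -> 'rV[R]_m :=
  cmap (mchart c') \o cinv (mchart c).

Lemma chart_imageP c U y : chart_image c U y ->
  [/\ cmap (mchart c) (cinv (mchart c) y) = y, U (cinv (mchart c) y) &
      cdom (mchart c) (cinv (mchart c) y)].
Proof. by move=> [p [Up cp] <-]; rewrite cmapK. Qed.

Lemma mem_chart_image c U p : U p -> cdom (mchart c) p ->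
  chart_image c U (cmap (mchart c) p).
Proof. by move=> Up cp; exists p. Qed.

Lemma chart_image_open c U : open U -> open (chart_image c U).
Proof.
move=> oU.
have -> : chart_image c U =
    (cmap (mchart c) @` cdom (mchart c)) `&` cinv (mchart c) @^-1` U.
  apply/seteqP; split=> y.
    by move=> [p [Up cp] <-]; split; [exists p|rewrite /= cmapK].
  by move=> [[p cp <-] /=]; rewrite cmapK // => Up; exists p.
apply: open_preimage_on; [exact: open_cimg| |exact: oU].
by move=> y; exact: cinv_continuous.
Qed.

Lemma chart_image_sub c U U' : U `<=` U' -> chart_image c U `<=` chart_image c U'.
Proof. by move=> sU y [p [/sU Up cp] <-]; exists p. Qed.

Lemma smooth_trans c c' : smooth_on (chart_image c (cdom (mchart c'))) (trans c c').
Proof. by have := mchart_compat c c'; rewrite setIC. Qed.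

Lemma transK c c' q : cdom (mchart c) q -> trans c c' (cmap (mchart c) q) = cmap (mchart c') q.
Proof. by move=> cq; rewrite /trans /= cmapK. Qed.

Lemma trans_differentiable c c' q : cdom (mchart c) q -> cdom (mchart c') q ->
  differentiable (trans c c') (cmap (mchart c) q).
Proof.
by move=> cq cq'; apply: (smooth_on_diff (@smooth_trans c c')); exact: mem_chart_image.
Qed.

Lemma near_chart c U q : open U -> U q -> cdom (mchart c) q ->
  \forall y \near cmap (mchart c) q, chart_image c U y.
Proof.
move=> oU Uq cq; apply: open_nbhs_nbhs; split; first exact: chart_image_open.
exact: mem_chart_image.
Qed.

Lemma jacobian_trans c c' c'' q :
  cdom (mchart c) q -> cdom (mchart c') q -> cdom (mchart c'') q ->
  'J (trans c c'') (cmap (mchart c) q) =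
  'J (trans c c') (cmap (mchart c) q) *m 'J (trans c' c'') (cmap (mchart c') q).
Proof.
move=> cq cq' cq''.
have d1 := trans_differentiable cq cq'.
have d2 := trans_differentiable cq' cq''.
rewrite -(transK c' cq) in d2 *.
rewrite -(jacobian_comp d1 d2); apply/esym.
apply: jacobian_near; last exact: differentiable_comp.
have := near_chart (open_cdom (mchart c')) cq' cq; apply: filterS => y.
by move=> /chart_imageP[_ cy' cy]; rewrite /trans /= cmapK.
Qed.

Lemma jacobian_trans_id c q : cdom (mchart c) q ->
  'J (trans c c) (cmap (mchart c) q) = 1%:M.
Proof.
move=> cq; rewrite -(jacobian_id (cmap (mchart c) q)).
apply: jacobian_near; last exact: trans_differentiable.
have := near_chart openT (I : setT q) cq; apply: filterS => y.
by move=> /chart_imageP[].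
Qed.

(** By the chain rule the preferred chart of [q] cancels, leaving a Jacobian between two fixed
    charts, which depends smoothly on [q]. *)
Lemma coord_frameM c c' q : cdom (mchart c) q -> cdom (mchart c') q ->
  coord_frame c q *m coord_coframe c' q = 'J (trans c c') (cmap (mchart c) q).
Proof. by move=> cq cq'; rewrite (jacobian_trans cq (mchart_mem q) cq'). Qed.

Lemma coord_frameK c q : cdom (mchart c) q ->
  coord_frame c q *m coord_coframe c q = 1%:M.
Proof. by move=> cq; rewrite coord_frameM // jacobian_trans_id. Qed.

Lemma coord_coframeK c q : cdom (mchart c) q ->
  coord_coframe c q *m coord_frame c q = 1%:M.
Proof. by move=> cq; apply: mulmx1C; exact: coord_frameK. Qed.

Lemma local_field_trans X c c' q : cdom (mchart c) q -> cdom (mchart c') q ->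
  local_field X c' (cmap (mchart c') q) =
  local_field X c (cmap (mchart c) q) *m 'J (trans c c') (cmap (mchart c) q).
Proof.
move=> cq cq'; rewrite /local_field (cmapK cq) (cmapK cq').
rewrite -(coord_frameM cq cq').
exact: (mulmx_insert _ _ (coord_coframeK cq)).
Qed.

Lemma open_trans_preimage c c' (B : set 'rV[R]_m) : open B ->
  open (chart_image c (cdom (mchart c')) `&` trans c c' @^-1` B).
Proof.
move=> oB; apply: open_preimage_on; last exact: oB.
  by apply: chart_image_open; exact: open_cdom.
by move=> y; exact: (smooth_on_continuous (@smooth_trans c c')).
Qed.

Lemma smooth_comp_trans c c' (W : normedModType R) (B : set 'rV[R]_m)
    (f : 'rV[R]_m -> W) : open B -> smooth_on B f ->
  smooth_on (chart_image c (cdom (mchart c')) `&` trans c c' @^-1` B) (f \o trans c c').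
Proof.
move=> oB Cf k; apply: Ck_on_comp (Cf k) => //.
- exact: open_trans_preimage.
- by move=> y [].
- by apply: Ck_on_sub (@smooth_trans c c' k) => y [].
Qed.

(** [smooth_field] speaks of all charts, but a change of chart only multiplies the local expression
    by a smooth transition Jacobian, so one chart near each point is enough. *)
Lemma smooth_field_local U X :
  (forall p, U p -> exists c B, [/\ open B, cdom (mchart c) p, B (cmap (mchart c) p) &
     smooth_on B (local_field X c)]) -> smooth_field U X.
Proof.
move=> H c' k; apply: Ck_on_local => y /chart_imageP[Ey Uy cy].
have [c [B [oB cp Bp CB]]] := H _ Uy.
have E : trans c' c y = cmap (mchart c) (cinv (mchart c') y) by [].
exists (chart_image c' (cdom (mchart c)) `&`
  trans c' c @^-1` (B `&` chart_image c (cdom (mchart c')))).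
  split; first by rewrite -Ey; exact: mem_chart_image.
  by split; rewrite /= ?E //; exact: mem_chart_image.
have oB' : open (B `&` chart_image c (cdom (mchart c'))).
  by apply: openI => //; apply: chart_image_open; exact: open_cdom.
pose f z := local_field X c z *m 'J (trans c c') z.
have Cf : smooth_on (B `&` chart_image c (cdom (mchart c'))) f.
  move=> j; apply: Ck_on_mulmx => //; first by apply: Ck_on_sub (CB j) => z [].
  apply: (Ck_on_sub (U := chart_image c (cdom (mchart c')))); first by move=> z [].
  apply: smooth_on_jacobian; last exact: smooth_trans.
  by apply: chart_image_open; exact: open_cdom.
apply: (Ck_on_ext (open_trans_preimage oB') _ (smooth_comp_trans c' c oB' Cf k)).
move=> z [/chart_imageP[Ez cz cz'] _].
by rewrite -[in RHS]Ez (local_field_trans _ cz cz').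
Qed.

Lemma smooth_fun_local U (f : M -> R) :
  (forall p, U p -> exists c B, [/\ open B, cdom (mchart c) p, B (cmap (mchart c) p) &
     smooth_on B (local_fun f c)]) -> smooth_fun U f.
Proof.
move=> H c' k; apply: Ck_on_local => y /chart_imageP[Ey Uy cy].
have [c [B [oB cp Bp CB]]] := H _ Uy.
have E : trans c' c y = cmap (mchart c) (cinv (mchart c') y) by [].
exists (chart_image c' (cdom (mchart c)) `&` trans c' c @^-1` B).
  by split; [rewrite -Ey; exact: mem_chart_image|rewrite /= E].
apply: (Ck_on_ext (open_trans_preimage oB) _ (smooth_comp_trans c' c oB CB k)).
by move=> z [/chart_imageP[Ez cz cz'] _]; rewrite /local_fun /trans /= cmapK.
Qed.

End ChartChanges.

(** * Smooth maps, tangent maps and pullbacks in charts *)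

Section SmoothMappings.
Variables (R : realType) (k m : nat) (N : manifold R k) (M : manifold R m).
Implicit Types (h : N -> M) (B : set 'rV[R]_k).

Definition chart_rep h (c : N) (c' : M) : 'rV[R]_k -> 'rV[R]_m :=
  cmap (mchart c') \o h \o cinv (mchart c).

Definition smooth_rep h c c' B :=
  [/\ open B, B `<=` chart_image c (h @^-1` cdom (mchart c')) &
      smooth_on B (chart_rep h c c')].

Definition smooth_mapping h := forall x, exists c c' B,
  [/\ cdom (mchart c) x, smooth_rep h c c' B & B (cmap (mchart c) x)].

(** Smoothness in some pair of charts moves to the prescribed pair by composing with transitions on
    both sides, on a domain shrunk so that source and target lie in both pairs of charts. *)
Lemma smooth_rep_charts h x c c' : smooth_mapping h ->
  cdom (mchart c) x -> cdom (mchart c') (h x) ->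
  exists2 B, smooth_rep h c c' B & B (cmap (mchart c) x).
Proof.
move=> Sh cx ch; have [d [d' [D [dx [oD sD CD] Dx]]]] := Sh x.
have [_ /= d'hx _] := chart_imageP (sD _ Dx); rewrite cmapK // in d'hx.
pose D' := D `&` chart_rep h d d' @^-1` chart_image d' (cdom (mchart c')).
have oD' : open D'.
  apply: open_preimage_on; first exact: oD; last first.
    by apply: chart_image_open; exact: open_cdom.
  by move=> y; exact: (smooth_on_continuous CD).
pose B := chart_image c (cdom (mchart d)) `&` trans c d @^-1` D'.
have oB : open B by exact: open_trans_preimage.
have CD' : smooth_on D' (trans d' c' \o chart_rep h d d').
  move=> j; apply: Ck_on_comp (@smooth_trans _ _ _ d' c' j) => //.
  - by apply: chart_image_open; exact: open_cdom.
  - by move=> y [].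
  - by apply: Ck_on_sub (CD j) => y [].
have HB y : B y -> [/\ cdom (mchart c) (cinv (mchart c) y),
     cmap (mchart c) (cinv (mchart c) y) = y,
     cdom (mchart d) (cinv (mchart c) y), cdom (mchart d') (h (cinv (mchart c) y)) &
     cdom (mchart c') (h (cinv (mchart c) y))].
  move=> [/chart_imageP[Ey dy cy] [/= Dy]].
  have [_ /=] := chart_imageP (sD _ Dy).
  rewrite /trans /chart_rep /= cmapK // => d'y _.
  by move=> /chart_imageP[_]; rewrite cmapK.
exists B; last first.
  split; first exact: mem_chart_image.
  rewrite /= transK //; split => //; rewrite /chart_rep /= cmapK //.
  exact: mem_chart_image.
split=> //.
  by move=> y /HB[cy Ey _ _ c'y]; rewrite -Ey; exact: mem_chart_image.
move=> j; apply: (Ck_on_ext oB _ (smooth_comp_trans c d oD' CD' j)) => y /HB[cy Ey dy d'y c'y].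
by rewrite /chart_rep /trans /= cmapK // cmapK.
Qed.

Lemma smooth_rep_differentiable h c c' B x : smooth_rep h c c' B ->
  B (cmap (mchart c) x) -> differentiable (chart_rep h c c') (cmap (mchart c) x).
Proof. by move=> [oB sB CB] Bx; exact: smooth_on_diff CB Bx. Qed.

(** The tangent map is defined with the preferred charts of [x] and [h x], which vary with [x].
    Factoring it through fixed charts isolates a middle factor that is smooth in [x]. *)
Lemma tangent_mapE h c c' B x : smooth_rep h c c' B -> cdom (mchart c) x ->
  B (cmap (mchart c) x) ->
  tangent_map h x =
  coord_coframe c x *m 'J (chart_rep h c c') (cmap (mchart c) x) *m coord_frame c' (h x).
Proof.
move=> SB cx Bx; have dH := smooth_rep_differentiable SB Bx.
have [oB sB CB] := SB.
have [_ /= c'h _] := chart_imageP (sB _ Bx); rewrite cmapK // in c'h.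
have d1 : differentiable (trans x c) (cmap (mchart x) x).
  by apply: trans_differentiable => //; exact: mchart_mem.
have d2 : differentiable (trans c' (h x)) (cmap (mchart c') (h x)).
  by apply: trans_differentiable => //; exact: mchart_mem.
have E1 : trans x c (cmap (mchart x) x) = cmap (mchart c) x by exact/transK/mchart_mem.
have E2 : chart_rep h c c' (cmap (mchart c) x) = cmap (mchart c') (h x).
  by rewrite /chart_rep /= cmapK.
rewrite -E2 in d2.
have d3 := differentiable_comp dH d2.
rewrite /coord_frame -E2 -mulmxA -/(trans c' (h x)) -(jacobian_comp dH d2).
rewrite /coord_coframe -/(trans x c) -E1 in dH d2 d3 *.
rewrite -(jacobian_comp d1 d3); apply/esym.
apply: jacobian_near; last exact: differentiable_comp.
have nB : \forall y \near cmap (mchart x) x,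
    (chart_image x (cdom (mchart c)) `&` trans x c @^-1` B) y.
  apply: open_nbhs_nbhs; split; first exact: open_trans_preimage.
  by split; [apply: mem_chart_image => //; exact: mchart_mem|rewrite /= E1].
apply: filterS nB => y [/chart_imageP[Ey cy xy] By].
have [_ /= c'hy _] := chart_imageP (sB _ By).
rewrite /trans /chart_rep /= cmapK // in c'hy *.
by rewrite cmapK.
Qed.

(** The frames and coframes of the preferred charts cancel on both sides, so the pullback is
    computed as between open sets of row spaces. *)
Lemma local_pullback h (w : M -> 'M[R]_m) c c' B y : smooth_rep h c c' B -> B y ->
  local_form2 (pullback_form2 h w) c y =
  'J (chart_rep h c c') y *m local_form2 w c' (chart_rep h c c' y)
    *m ('J (chart_rep h c c') y)^T.
Proof.
move=> SB By; have [oB sB CB] := SB.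
have [Ey /= c'h cy] := chart_imageP (sB _ By).
rewrite /local_form2 /chart_rep /= cmapK // /pullback_form2 -/(chart_rep h c c').
rewrite (tangent_mapE SB cy) ?Ey //.
rewrite !trmx_mul !mulmxA coord_frameK // mul1mx -!mulmxA; do 4!congr (_ *m _).
rewrite -trmx_mul coord_frameK // trmx1 mulmx1.
by [].
Qed.

Lemma smooth_pullback h (w : M -> 'M[R]_m) : smooth_mapping h ->
  smooth_form2 setT w -> smooth_form2 setT (pullback_form2 h w).
Proof.
move=> Sh Sw c j; apply: Ck_on_local => y /chart_imageP[Ey _ cy].
have [B SB By] := smooth_rep_charts Sh cy (mchart_mem _); rewrite Ey in By.
set c' := h _ in SB; have [oB sB CB] := SB; exists B => //.
apply: (Ck_on_ext oB) => [z Bz|]; first exact/esym/(local_pullback _ SB Bz).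
have CJ : Ck_on j B (fun z => 'J (chart_rep h c c') z).
  exact: smooth_on_jacobian.
have CJT : Ck_on j B (fun z => ('J (chart_rep h c c') z)^T).
  by apply: (Ck_on_mlinear (@trmx R k m)).
apply: Ck_on_mulmx => //; apply: Ck_on_mulmx => //.
apply: Ck_on_comp (CB j) (Sw c' j) => //; first exact/chart_image_open/openT.
move=> z /sB/chart_imageP[_ /= c'z _].
exact: mem_chart_image.
Qed.

End SmoothMappings.

Lemma tangent_map_comp (R : realType) (l k m : nat) (L : manifold R l)
    (N : manifold R k) (M : manifold R m) (h : L -> N) (g : N -> M) x :
  smooth_mapping h -> smooth_mapping g ->
  tangent_map (g \o h) x = tangent_map h x *m tangent_map g (h x).
Proof.
move=> Sh Sg.
have [B SB Bx] := smooth_rep_charts Sh (mchart_mem x) (mchart_mem (h x)).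
have [D SD Dx] := smooth_rep_charts Sg (mchart_mem (h x)) (mchart_mem (g (h x))).
have dh := smooth_rep_differentiable SB Bx.
have dg := smooth_rep_differentiable SD Dx.
have E : chart_rep h x (h x) (cmap (mchart x) x) = cmap (mchart (h x)) (h x).
  by rewrite /chart_rep /= cmapK //; exact: mchart_mem.
rewrite /tangent_map -/(chart_rep h x (h x)) -/(chart_rep g (h x) (g (h x))) -E in dg *.
rewrite -(jacobian_comp dh dg); apply/esym; apply: jacobian_near.
  have [oB sB _] := SB.
  have nB : \forall y \near cmap (mchart x) x, B y by exact: open_nbhs_nbhs.
  apply: filterS nB => y /sB/chart_imageP[_ /= hy _].
  by rewrite /chart_rep /= cmapK.
exact: differentiable_comp.
Qed.

(** * Closed 2-forms *)

Section ClosedForms.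
Variable R : realType.

Lemma form2_eval_mul k m (A : 'M[R]_(k, m)) (B : 'M[R]_m) (u v : 'rV[R]_k) :
  form2_eval (A *m B *m A^T) u v = form2_eval B (u *m A) (v *m A).
Proof. by rewrite /form2_eval trmx_mul !mulmxA. Qed.

Lemma form2_eval_delta m (B : 'M[R]_m) i j :
  form2_eval B (delta_mx 0 i) (delta_mx 0 j) = B i j.
Proof. by rewrite /form2_eval -rowE trmx_delta -colE !mxE. Qed.

Lemma congr_mxE k m (A : 'M[R]_(k, m)) (B : 'M[R]_m) i j :
  (A *m B *m A^T) i j = form2_eval B (row i A) (row j A).
Proof. by rewrite -form2_eval_delta form2_eval_mul -!rowE. Qed.

Lemma form2_evalDl m (B : 'M[R]_m) a u u' v :
  form2_eval B (a *: u + u') v = a * form2_eval B u v + form2_eval B u' v.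
Proof. by rewrite /form2_eval !mulmxDl -!scalemxAl !mxE. Qed.

Lemma form2_evalDr m (B : 'M[R]_m) a u v v' :
  form2_eval B u (a *: v + v') = a * form2_eval B u v + form2_eval B u v'.
Proof. by rewrite /form2_eval linearP mulmxDr -scalemxAr !mxE. Qed.

Lemma form2_evalDm m (B B' : 'M[R]_m) a u v :
  form2_eval (a *: B + B') u v = a * form2_eval B u v + form2_eval B' u v.
Proof. by rewrite /form2_eval mulmxDr mulmxDl -scalemxAr -scalemxAl !mxE. Qed.

(** Used one slot at a time, this reduces a multilinear identity to coordinate vectors. *)
Lemma row_linear_eq0 m (F : 'rV[R]_m -> R) :
  (forall a u v, F (a *: u + v) = a * F u + F v) ->
  (forall i, F (delta_mx 0 i) = 0) -> forall u, F u = 0.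
Proof.
move=> lF F0 u.
have F00 : F 0 = 0 by have := lF (-1) 0 0; rewrite scaler0 addr0 mulN1r addNr.
rewrite [u]row_sum_delta; elim/big_rec : _ => // i v _ Fv.
by rewrite lF F0 Fv mulr0 addr0.
Qed.

(* The terms of [d w] in which a coordinate field gets differentiated cancel
   because their derivatives [N] commute. *)
Lemma cyclic_cancel m (B : 'M[R]_m) (n : nat) (X : 'I_n -> 'rV[R]_m)
    (N : 'I_n -> 'I_n -> 'rV[R]_m) :
  (forall u v, form2_eval B u v = - form2_eval B v u) ->
  (forall i j, N i j = N j i) ->
  forall i j k,
  (form2_eval B (N i j) (X k) + form2_eval B (X j) (N i k)) +
  (form2_eval B (N j k) (X i) + form2_eval B (X k) (N j i)) +
  (form2_eval B (N k i) (X j) + form2_eval B (X i) (N k j)) = 0.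
Proof.
move=> aB sN i j k; rewrite (sN k i) (sN j i) (sN k j).
rewrite (aB (X j)) (aB (X k)) (aB (X i)).
ring.
Qed.

Lemma diff_near (V W : normedModType R) (f g : V -> W) x v : {near x, f =1 g} ->
  differentiable f x -> 'd g x v = 'd f x v.
Proof. by move=> fg df; have [_ ->] := near_eq_differentiable fg df. Qed.

Lemma diff_compE (U V W : normedModType R) (f : U -> V) (g : V -> W) x v :
  differentiable f x -> differentiable g (f x) ->
  'd (g \o f) x v = 'd g (f x) ('d f x v).
Proof. by move=> df dg; exact: (congr1 (fun h => h v) (diff_comp df dg)). Qed.

Lemma diff_coord (V : normedModType R) m n (f : V -> 'M[R]_(m, n)) x v i j :
  differentiable f x ->
  differentiable (fun z => f z i j : R^o) x /\
  'd (fun z => f z i j : R^o) x v = ('d f x v) i j.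
Proof.
move=> df.
pose LM := GRing.isLinear.Build _ _ _ _ _ (@coord_is_linear R m n i j).
pose L : {linear 'M[R]_(m, n) -> R^o} := HB.pack (fun A : 'M[R]_(m, n) => A i j : R^o) LM.
have cL := @matrix_linear_continuous _ _ _ _ L.
have dL := linear_differentiable (f x) cL.
split; first exact: (differentiable_comp df dL).
apply: etrans (diff_compE v df dL) _.
exact: (congr1 (fun h : 'M[R]_(m, n) -> R^o => h _) (diff_lin (f x) cL)).
Qed.

Lemma mulmx_is_bilinear m n p : bilinear_for
    (GRing.Scale.Law.clone _ _ *:%R _) (GRing.Scale.Law.clone _ _ *:%R _)
    (fun (A : 'M[R]_(m, n)) (B : 'M[R]_(n, p)) => A *m B).
Proof.
split=> [u'|u] a x y /=; first by rewrite mulmxDl scalemxAl.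
by rewrite mulmxDr scalemxAr.
Qed.

Lemma diff_mulmx (V : normedModType R) m n p (f : V -> 'M[R]_(m, n))
    (g : V -> 'M[R]_(n, p)) x v : differentiable f x -> differentiable g x ->
  differentiable (fun z => f z *m g z) x /\
  'd (fun z => f z *m g z) x v = f x *m 'd g x v + 'd f x v *m g x.
Proof.
move=> df dg.
pose bM := bilinear_isBilinear.Build R 'M[R]_(m, n) 'M[R]_(n, p) 'M[R]_(m, p) _ _
  (fun (A : 'M[R]_(m, n)) (B : 'M[R]_(n, p)) => A *m B) (@mulmx_is_bilinear m n p).
pose b : {bilinear 'M[R]_(m, n) -> 'M[R]_(n, p) -> 'M[R]_(m, p)} :=
  HB.pack (fun (A : 'M[R]_(m, n)) (B : 'M[R]_(n, p)) => A *m B) bM.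
have cb : continuous (fun q : 'M[R]_(m, n) * 'M[R]_(n, p) => b q.1 q.2).
  move=> q; have H : Ck_on 0 [set: 'M[R]_(m, n) * 'M[R]_(n, p)] (fun q => q.1 *m q.2).
    apply: Ck_on_mulmx; first exact: openT.
      by move=> z _; exact: cvg_fst.
    by move=> z _; exact: cvg_snd.
  exact: H.
have dp := differentiable_pair df dg.
have dB := differentiable_bilin (f x, g x) cb.
split; first exact: (differentiable_comp dp dB).
apply: etrans (diff_compE v dp dB) _.
have E := congr1 (fun h : V -> _ => h v) (diff_pair df dg).
apply: etrans (congr1 _ E) _.
exact: (congr1 (fun h : _ -> 'M[R]_(m, p) => h ('d f x v, 'd g x v)) (diff_bilin (f x, g x) cb)).
Qed.

Lemma form2_eval_leibniz m (B B' : 'M[R]_m) (u u' v v' : 'rV[R]_m) :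
  (u *m B *m v'^T + (u *m B' + u' *m B) *m v^T) 0 0 =
  form2_eval B' u v + (form2_eval B u' v + form2_eval B u v').
Proof. by rewrite mulmxDl [LHS]mxE [X in _ + X]mxE addrC -addrA. Qed.

Lemma diff_form2_eval (V : normedModType R) m (B : V -> 'M[R]_m)
    (X Y : V -> 'rV[R]_m) x v :
  differentiable B x -> differentiable X x -> differentiable Y x ->
  'd (fun z => form2_eval (B z) (X z) (Y z) : R^o) x v =
  form2_eval ('d B x v) (X x) (Y x) +
  (form2_eval (B x) ('d X x v) (Y x) + form2_eval (B x) (X x) ('d Y x v)).
Proof.
move=> dB dX dY.
have [d1 E1] := diff_mulmx v dX dB.
have cT := @matrix_linear_continuous R 1 m 'M[R]_(m, 1) (@trmx R 1 m).
have dT := linear_differentiable (Y x) cT.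
have dYT : differentiable (fun z => (Y z)^T) x by exact: (differentiable_comp dY dT).
have ET : 'd (fun z => (Y z)^T) x v = ('d Y x v)^T.
  apply: etrans (diff_compE v dY dT) _.
  exact: (congr1 (fun h : 'rV[R]_m -> 'cV[R]_m => h _) (diff_lin (Y x) cT)).
have [d2 E2] := diff_mulmx v d1 dYT.
have [_ E3] := diff_coord v 0 0 d2.
apply: etrans E3 _; apply: etrans (congr1 (fun A : 'M[R]_1 => A 0 0) E2) _.
apply: etrans (congr1 (fun A : 'M[R]_1 => A 0 0)
  (congr2 +%R (congr1 (fun T => X x *m B x *m T) ET)
              (congr1 (fun T => T *m (Y x)^T) E1))) _.
exact: form2_eval_leibniz.
Qed.

Lemma diff2_sym_row (V : normedModType R) m (U : set V) (f : V -> 'rV[R]_m) x u v :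
  open U -> U x -> smooth_on U f ->
  'd (fun z => 'd f z u) x v = 'd (fun z => 'd f z v) x u.
Proof.
move=> oU Ux Cf; apply/rowP => l.
have H (a b : V) : ('d (fun z => 'd f z a) x b) 0 l =
    'd (fun z => 'd (fun z => f z 0 l : R^o) z a : R^o) x b.
  have dfa : differentiable (fun z => 'd f z a) x.
    exact: (smooth_on_diff (smooth_on_diffv a Cf)).
  have [dl <-] := diff_coord b 0 l dfa.
  apply/esym/diff_near => //; apply: (open_eq_near oU Ux) => y Uy.
  by have [_ ->] := diff_coord a 0 l (smooth_on_diff Cf Uy).
rewrite !H; apply: (diff2_sym _ _ oU Ux).
exact: (Ck_on_coord (f := f)).
Qed.

Lemma local_form2_sym m (M : manifold R m) (w : M -> 'M[R]_m) c y u v :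
  (forall p u v, form2_eval (w p) u v = - form2_eval (w p) v u) ->
  form2_eval (local_form2 w c y) u v = - form2_eval (local_form2 w c y) v u.
Proof. by move=> aw; rewrite /local_form2 !form2_eval_mul aw. Qed.

Lemma sum3_eq0 (V : zmodType) (a b c a' b' c' : V) :
  a + b + c = 0 -> a' + b' + c' = 0 -> a + a' + (b + b') + (c + c') = 0.
Proof. by move=> H H'; rewrite (addrACA a) (addrACA (a + b)) H H' addr0. Qed.

(** [closed_form2] tests coordinate vectors only; for a pullback the test vectors are images of
    coordinate vectors under a differential, hence arbitrary. Trilinearity bridges the gap. *)
Lemma closed_form2_trilinear m (M : manifold R m) (w : M -> 'M[R]_m) c y :
  smooth_form2 setT w -> closed_form2 w -> chart_image c setT y ->
  forall u v t,
  form2_eval ('d (local_form2 w c) y u) v t + form2_eval ('d (local_form2 w c) y v) t u +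
  form2_eval ('d (local_form2 w c) y t) u v = 0.
Proof.
move=> Sw Cw cy.
have dW := smooth_on_diff (Sw c) cy.
have E a i j : 'd (fun z => local_form2 w c z i j : R^o) y a = ('d (local_form2 w c) y a) i j.
  by have [_] := diff_coord a i j dW.
have H i j k : form2_eval ('d (local_form2 w c) y (delta_mx 0 i)) (delta_mx 0 j) (delta_mx 0 k)
  + form2_eval ('d (local_form2 w c) y (delta_mx 0 j)) (delta_mx 0 k) (delta_mx 0 i)
  + form2_eval ('d (local_form2 w c) y (delta_mx 0 k)) (delta_mx 0 i) (delta_mx 0 j) = 0.
  by rewrite !form2_eval_delta -!E; exact: Cw.
have lin a u v : 'd (local_form2 w c) y (a *: u + v) =
    a *: 'd (local_form2 w c) y u + 'd (local_form2 w c) y v by rewrite linearP.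
move=> u v t; move: u; apply: row_linear_eq0 => [a u u'|i].
  by rewrite lin form2_evalDm form2_evalDl form2_evalDr; ring.
move: v; apply: row_linear_eq0 => [a u u'|j].
  by rewrite lin form2_evalDm form2_evalDl form2_evalDr; ring.
move: t; apply: row_linear_eq0 => [a u u'|k].
  by rewrite lin form2_evalDm form2_evalDl form2_evalDr; ring.
exact: H.
Qed.

Lemma closed_pullback k m (N : manifold R k) (M : manifold R m) (h : N -> M)
    (w : M -> 'M[R]_m) : smooth_mapping h -> is_form2 w -> closed_form2 w ->
  closed_form2 (pullback_form2 h w).
Proof.
move=> Sh [Sw aw] Cw c y i j l /chart_imageP[Ey _ cy] /=.
have [B SB By] := smooth_rep_charts Sh cy (mchart_mem _); rewrite Ey in By.
set c' := h _ in SB; have [oB sB CB] := SB.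
set H := chart_rep h c c' in CB.
have dH := smooth_on_diff CB By.
have HB z : B z -> chart_image c' setT (H z).
  by move=> /sB/chart_imageP[_ /= c'z _]; exact: mem_chart_image.
have dW : differentiable (local_form2 w c') (H y) by exact: (smooth_on_diff (Sw c') (HB _ By)).
have dWH := differentiable_comp dH dW.
have d2 b : differentiable (fun z => 'd H z (delta_mx 0 b)) y.
  exact: (smooth_on_diff (smooth_on_diffv _ CB)).
(* By the Leibniz rule the derivative of the pullback splits into a derivative of [w] evaluated on
   the [X a], and terms containing the second derivatives [N' a b]. The cyclic sum of the former
   vanishes by closedness, that of the latter by the symmetry of [N']. *)
pose N' a b := 'd (fun z => 'd H z (delta_mx 0 b)) y (delta_mx 0 a) : 'rV[R]_m.
pose X a := 'd H y (delta_mx 0 a) : 'rV[R]_m.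
have key a b d : 'd (fun z => local_form2 (pullback_form2 h w) c z b d : R^o) y (delta_mx 0 a)
  = form2_eval ('d (local_form2 w c') (H y) (X a)) (X b) (X d) +
    (form2_eval (local_form2 w c' (H y)) (N' a b) (X d)
     + form2_eval (local_form2 w c' (H y)) (X b) (N' a d)).
  have E := diff_form2_eval (delta_mx 0 a) dWH (d2 b) (d2 d).
  rewrite (diff_compE _ dH dW) in E; rewrite -E.
  have Ez z : B z -> form2_eval ((local_form2 w c' \o H) z) ('d H z (delta_mx 0 b))
      ('d H z (delta_mx 0 d)) =
       local_form2 (pullback_form2 h w) c z b d.
    by move=> Bz; rewrite (local_pullback w SB Bz) congr_mxE !row_jacobian.
  apply: (diff_near (W := R^o) _ (open_eq_near (W := R^o) oB By Ez)).
  have Cpb := @smooth_pullback _ _ _ _ _ h w Sh Sw c.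
  have dpb : differentiable (local_form2 (pullback_form2 h w) c) y.
    by apply: (smooth_on_diff Cpb); rewrite -Ey; exact: mem_chart_image.
  have [dpbd _] := diff_coord 0 b d dpb.
  apply: (near_eq_differentiable _ dpbd).1.
  by apply: (open_eq_near oB By) => z Bz; rewrite Ez.
apply: etrans (congr2 +%R (congr2 +%R (key i j l) (key j l i)) (key l i j)) _.
have T := closed_form2_trilinear Sw Cw (HB _ By) (X i) (X j) (X l).
have Ns a b : N' a b = N' b a by exact: (diff2_sym_row _ _ oB By CB).
have C := cyclic_cancel X (fun u v => local_form2_sym c' (H y) u v aw) Ns i j l.
exact: (sum3_eq0 T C).
Qed.

End ClosedForms.

(** * Coordinate vector fields and torsion-free connections *)

Section CoordinateFields.
Variables (R : realType) (m : nat) (M : manifold R m).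
Implicit Types (p q c : M).

Definition coord_field c (i : 'I_m) q : 'rV[R]_m := row i (coord_frame c q).

Lemma coord_field_coframe c i q : cdom (mchart c) q ->
  coord_field c i q *m coord_coframe c q = delta_mx 0 i.
Proof. by move=> cq; rewrite /coord_field -row_mul coord_frameK // row1. Qed.

Lemma smooth_coord_field c i : smooth_field (cdom (mchart c)) (coord_field c i).
Proof.
apply: smooth_field_local => p cp; exists c, (chart_image c setT); split=> //.
- exact/chart_image_open/openT.
- exact: mem_chart_image.
- move=> k; apply: (Ck_on_ext (f := fun=> delta_mx 0 i)); last exact: Ck_on_cst.
    exact/chart_image_open/openT.
  move=> y /chart_imageP[_ _ cy].
  by rewrite /local_field coord_field_coframe.
Qed.

Lemma diff_trans_coord_field c i q : cdom (mchart c) q ->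
  'd (trans q c) (cmap (mchart q) q) (coord_field c i q) = delta_mx 0 i.
Proof. by move=> cq; rewrite -jacobianE; exact: coord_field_coframe. Qed.

Lemma dir_deriv_coord_field c i q (f : M -> R) : cdom (mchart c) q ->
  differentiable (local_fun f c) (cmap (mchart c) q) ->
  dir_deriv f q (coord_field c i q) =
  'd (local_fun f c) (cmap (mchart c) q) (delta_mx 0 i).
Proof.
move=> cq df; have qq := mchart_mem q.
have dt := trans_differentiable qq cq.
rewrite -(transK c qq) in df *.
rewrite -(diff_trans_coord_field i cq) -(diff_compE _ dt df).
rewrite /dir_deriv.
apply: diff_near; last exact: (differentiable_comp dt df).
have := near_chart (open_cdom (mchart c)) cq qq; apply: filterS => y.
by move=> /chart_imageP[Ey cy qy]; rewrite /local_fun /trans /= cmapK.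
Qed.

(** In the chart around [q] the components of the coordinate fields of [c] are the partial
    derivatives of the transition map, so the bracket is a difference of mixed second
    derivatives. *)
Lemma lie_bracket_coord_field c i j q : cdom (mchart c) q ->
  lie_bracket (coord_field c i) (coord_field c j) q = 0.
Proof.
move=> cq; have qq := mchart_mem q.
have dt := trans_differentiable qq cq.
have C := @smooth_trans _ _ _ c q.
have oC : open (chart_image c (cdom (mchart q))) by exact/chart_image_open/open_cdom.
have Cq : chart_image c (cdom (mchart q)) (cmap (mchart c) q) by exact: mem_chart_image.
have H a b : 'd (local_field (coord_field c b) q) (cmap (mchart q) q) (coord_field c a q) =
    'd (fun y => 'd (trans c q) y (delta_mx 0 b)) (cmap (mchart c) q) (delta_mx 0 a).
  have d2 : differentiable (fun y => 'd (trans c q) y (delta_mx 0 b)) (cmap (mchart c) q).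
    exact: (smooth_on_diff (smooth_on_diffv _ C)).
  rewrite -(transK c qq) in d2 *.
  apply: etrans (congr1 _ (diff_trans_coord_field a cq)).
  apply: etrans (diff_compE _ dt d2).
  apply: diff_near; last exact: (differentiable_comp dt d2).
  have := near_chart (open_cdom (mchart c)) cq qq; apply: filterS => y.
  move=> /chart_imageP[Ey cy qy].
  by rewrite /local_field /coord_field -row_mul coord_frameM // row_jacobian.
apply/eqP; rewrite /lie_bracket subr_eq0; apply/eqP.
apply: etrans (H i j) (etrans _ (esym (H j i))).
exact: (diff2_sym_row _ _ oC Cq C).
Qed.

(* In coordinates, [d w] is the sum of the [w (nabla_i d_j) d_k + w d_j (nabla_i d_k)],
   and [nabla_i d_j] is symmetric since coordinate fields commute. *)
Lemma parallel_closed (w : M -> 'M[R]_m) nabla : is_form2 w ->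
  torsion_free nabla -> parallel_form2 nabla w -> closed_form2 w.
Proof.
move=> [Sw aw] tf pf c y i j k /chart_imageP[Ey _ cy] /=.
set q := cinv (mchart c) y in cy Ey *.
have oc := open_cdom (mchart c).
pose N a b := nabla q (coord_field c a q) (coord_field c b).
have Ns a b : N a b = N b a.
  apply/eqP; rewrite -subr_eq0; apply/eqP.
  rewrite /N (tf _ _ _ _ oc cy); try exact: smooth_coord_field.
  exact: lie_bracket_coord_field.
have cyT : chart_image c setT y by rewrite -Ey; exact: mem_chart_image.
have key a b d : 'd (fun z => local_form2 w c z b d : R^o) y (delta_mx 0 a) =
  form2_eval (w q) (N a b) (coord_field c d q) + form2_eval (w q) (coord_field c b q) (N a d).
  have Sb e := @smooth_coord_field c e.
  have E := pf _ _ (coord_field c a q) _ _ oc cy (Sb b) (Sb d).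
  rewrite -E.
  have [dWbd _] := diff_coord 0 b d (smooth_on_diff (Sw c) cyT).
  have El : {near y, (fun z => local_form2 w c z b d : R^o) =1
     local_fun (fun p => form2_eval (w p) (coord_field c b p) (coord_field c d p)) c}.
    apply: (open_eq_near (U := chart_image c setT));
      [exact/chart_image_open/openT|exact: cyT|] => z _.
    by rewrite /local_form2 congr_mxE.
  have [dl El'] := near_eq_differentiable El dWbd.
  rewrite -Ey in dl.
  apply: etrans (esym (dir_deriv_coord_field a cy dl)).
  rewrite Ey; exact: (congr1 (fun h : 'rV[R]_m -> R^o => h _) (esym El')).
apply: etrans (congr2 +%R (congr2 +%R (key i j k) (key j k i)) (key k i j)) _.
exact: (cyclic_cancel (fun a => coord_field c a q) (aw q) Ns).
Qed.

End CoordinateFields.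

(** * Quaternions and admissible frames *)

Section QuaternionAlgebra.
Variable R : realType.
Implicit Types (x y z q : 'rV[R]_4).

Lemma qmulE x y :
  (qmul x y 0 (inord 0) = x 0 (inord 0) * y 0 (inord 0) - x 0 (inord 1) * y 0 (inord 1)
     - x 0 (inord 2) * y 0 (inord 2) - x 0 (inord 3) * y 0 (inord 3)) *
  (qmul x y 0 (inord 1) = x 0 (inord 0) * y 0 (inord 1) + x 0 (inord 1) * y 0 (inord 0)
     + x 0 (inord 2) * y 0 (inord 3) - x 0 (inord 3) * y 0 (inord 2)) *
  (qmul x y 0 (inord 2) = x 0 (inord 0) * y 0 (inord 2) - x 0 (inord 1) * y 0 (inord 3)
     + x 0 (inord 2) * y 0 (inord 0) + x 0 (inord 3) * y 0 (inord 1)) *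
  (qmul x y 0 (inord 3) = x 0 (inord 0) * y 0 (inord 3) + x 0 (inord 1) * y 0 (inord 2)
     - x 0 (inord 2) * y 0 (inord 1) + x 0 (inord 3) * y 0 (inord 0)).
Proof. by do 3?split; rewrite mxE inordK. Qed.

Lemma qextP x y :
  [/\ x 0 (inord 0) = y 0 (inord 0), x 0 (inord 1) = y 0 (inord 1),
      x 0 (inord 2) = y 0 (inord 2) & x 0 (inord 3) = y 0 (inord 3)] -> x = y.
Proof.
move=> [H0 H1 H2 H3]; apply/rowP => i; rewrite -(inord_val i).
by case: i => -[|[|[|[|]]]].
Qed.

Lemma qconjE x :
  (qconj x 0 (inord 0) = x 0 (inord 0)) * (qconj x 0 (inord 1) = - x 0 (inord 1)) *
  (qconj x 0 (inord 2) = - x 0 (inord 2)) * (qconj x 0 (inord 3) = - x 0 (inord 3)).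
Proof. by do 3?split; rewrite mxE -val_eqE /= inordK. Qed.

Definition qone : 'rV[R]_4 := qbasis R 0.

Lemma qoneE :
  (qone 0 (inord 0) = 1) * (qone 0 (inord 1) = 0) *
  (qone 0 (inord 2) = 0) * (qone 0 (inord 3) = 0).
Proof. by do 3?split; rewrite mxE eqxx /= -val_eqE /= inordK. Qed.

Lemma qmulA x y z : qmul x (qmul y z) = qmul (qmul x y) z.
Proof. by apply: qextP; rewrite !qmulE; split; ring. Qed.

Lemma qmul1l x : qmul qone x = x.
Proof. by apply: qextP; rewrite !qmulE !qoneE; split; ring. Qed.

Lemma qmul1r x : qmul x qone = x.
Proof. by apply: qextP; rewrite !qmulE !qoneE; split; ring. Qed.

Lemma qmul_linearr x : linear (qmul x).
Proof. by move=> a y z; apply: qextP; rewrite !qmulE !mxE !inordK //=; split; ring. Qed.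

Lemma qmul_linearl y : linear (fun x => qmul x y).
Proof. by move=> a x z; apply: qextP; rewrite !qmulE !mxE !inordK //=; split; ring. Qed.

HB.instance Definition _ x := GRing.isLinear.Build R 'rV[R]_4 'rV[R]_4 _ (qmul x)
  (qmul_linearr x).

Lemma qmulZl a x y : qmul (a *: x) y = a *: qmul x y.
Proof.
have := qmul_linearl y a x 0; rewrite /= addr0 => ->.
suff -> : qmul 0 y = 0 by rewrite addr0.
by apply: qextP; rewrite !qmulE !mxE; split; ring.
Qed.

Lemma qmulZr a x y : qmul x (a *: y) = a *: qmul x y.
Proof. by rewrite linearZ. Qed.

Lemma qmul_suml (I : Type) (r : seq I) (P : pred I) (F : I -> 'rV[R]_4) y :
  qmul (\sum_(i <- r | P i) F i) y = \sum_(i <- r | P i) qmul (F i) y.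
Proof.
apply: (big_morph (fun x => qmul x y)) => [x z|].
  by have := qmul_linearl y 1 x z; rewrite !scale1r.
by apply: qextP; rewrite !qmulE !mxE; split; ring.
Qed.

Lemma qconj_mul x y : qconj (qmul x y) = qmul (qconj y) (qconj x).
Proof. by apply: qextP; rewrite !(qmulE, qconjE); split; ring. Qed.

Definition qnormsq x : R := \sum_i x 0 i ^+ 2.

Lemma sum4E (F : 'I_4 -> R) :
  \sum_i F i = F (inord 0) + F (inord 1) + F (inord 2) + F (inord 3).
Proof.
rewrite !big_ord_recl big_ord0 addr0 !addrA; do !congr (_ + _); congr F;
by apply/val_inj; rewrite /= inordK.
Qed.

Lemma qmul_conj x : qmul x (qconj x) = qnormsq x *: qone.
Proof.
apply: qextP; rewrite !mxE /qnormsq sum4E -!val_eqE /= !inordK //= -/qone.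
by rewrite -?val_eqE /= ?inordK //=; split; ring.
Qed.

Lemma qconj_mulr x : qmul (qconj x) x = qnormsq x *: qone.
Proof.
apply: qextP; rewrite !mxE /qnormsq sum4E -!val_eqE /= !inordK //= -/qone.
by rewrite -?val_eqE /= ?inordK //=; split; ring.
Qed.

Lemma qnormsq_ge0 x : 0 <= qnormsq x.
Proof. by apply: sumr_ge0 => i _; exact: sqr_ge0. Qed.

Lemma qnormsq_eq0 x : (qnormsq x == 0) = (x == 0).
Proof.
apply/eqP/eqP => [/eqP|->]; last by rewrite /qnormsq big1 // => i _; rewrite mxE expr0n.
rewrite psumr_eq0 => [/allP H|i _]; last exact: sqr_ge0.
by apply/rowP => i; have := H i (mem_index_enum _); rewrite sqrf_eq0 mxE => /eqP.
Qed.

Lemma qnorm_sq x : qnorm x ^+ 2 = qnormsq x.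
Proof. exact/sqr_sqrtr/qnormsq_ge0. Qed.

Lemma qnormsq_mul x y : qnormsq (qmul x y) = qnormsq x * qnormsq y.
Proof. by rewrite /qnormsq !sum4E !qmulE; ring. Qed.

Lemma qnorm_mul x y : qnorm (qmul x y) = qnorm x * qnorm y.
Proof.
rewrite /qnorm -!/(qnormsq _) qnormsq_mul sqrtrM //; exact: qnormsq_ge0.
Qed.

Lemma qnorm_gt0 x : x != 0 -> 0 < qnorm x.
Proof.
by move=> x0; rewrite sqrtr_gt0 lt_neqAle qnormsq_ge0 andbT eq_sym qnormsq_eq0.
Qed.

Lemma qone_neq0 : qone != 0.
Proof. by apply/eqP => /rowP/(_ (inord 0)); rewrite qoneE mxE => /eqP; rewrite oner_eq0. Qed.

Lemma qnorm_one : qnorm qone = 1.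
Proof. by rewrite /qnorm sum4E !qoneE !expr0n /= expr1n !addr0 sqrtr1. Qed.

Definition qinv x : 'rV[R]_4 := (qnormsq x)^-1 *: qconj x.

Lemma qmulVK x y : x != 0 -> qmul (qinv x) (qmul x y) = y.
Proof.
move=> x0; rewrite qmulA qmulZl qconj_mulr scalerA mulVf ?qnormsq_eq0 //.
by rewrite scale1r qmul1l.
Qed.

Lemma qmulKV x y : x != 0 -> qmul x (qmul (qinv x) y) = y.
Proof.
move=> x0; rewrite qmulA linearZ /= qmul_conj scalerA mulVf ?qnormsq_eq0 //.
by rewrite scale1r qmul1l.
Qed.

Definition qim (v : 'I_3 -> R) : 'rV[R]_4 := \row_i oapp v 0 (unlift 0 i).

Lemma qim_lift v a : qim v 0 (lift 0 a) = v a.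
Proof. by rewrite mxE liftK. Qed.

Lemma qim0 v : qim v 0 0 = 0.
Proof. by rewrite mxE unlift_none. Qed.

Lemma qimP x : x 0 0 = 0 -> x = qim (fun a => x 0 (lift 0 a)).
Proof.
move=> x0; apply/rowP => i.
by case: (unliftP 0 i) => [a ->|->]; rewrite ?qim_lift ?qim0.
Qed.

Lemma qim_sum v : qim v = \sum_a v a *: qbasis R (lift 0 a).
Proof.
apply/rowP => i; rewrite summxE; case: (unliftP 0 i) => [a ->|->].
  rewrite qim_lift (bigD1 a) //= !mxE !eqxx mulr1 big1 ?addr0 // => b ba.
  by rewrite !mxE eqxx (inj_eq lift_inj) eq_sym (negbTE ba) mulr0.
by rewrite qim0 big1 // => b _; rewrite !mxE eqxx /= mulr0.
Qed.

(** Left unnormalized, this is |q|^2 times the rotation by [q]. It is then polynomial in the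
    components, and the division by [qnormsq q] stays outside. *)
Definition qconjugate q y := qmul (qmul q y) (qconj q).

Lemma inord0 : inord 0 = 0 :> 'I_4.
Proof. by apply/val_inj; rewrite /= inordK. Qed.

Lemma qconjugate_im q (v : 'rV[R]_4) : v 0 0 = 0 -> qconjugate q v 0 0 = 0.
Proof.
by rewrite -inord0 => v0; rewrite /qconjugate !qmulE !qconjE v0; ring.
Qed.

Lemma qbasis_im (b : 'I_3) : qbasis R (lift 0 b) 0 0 = 0.
Proof. by rewrite mxE. Qed.

Lemma qrot_im q b : qim (fun a => qrot q a b) =
  (qnormsq q)^-1 *: qconjugate q (qbasis R (lift 0 b)).
Proof.
rewrite [RHS]qimP; last by rewrite mxE qconjugate_im ?mulr0 ?qbasis_im.
congr qim; apply/funext => a.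
by rewrite [RHS]mxE mxE qnorm_sq mulrC.
Qed.

Lemma qconjugate_mul q q' y : qconjugate (qmul q q') y = qconjugate q (qconjugate q' y).
Proof. by rewrite /qconjugate qconj_mul !qmulA. Qed.

Lemma qconjugateZ q a y : qconjugate q (a *: y) = a *: qconjugate q y.
Proof. by rewrite /qconjugate linearZ /= qmulZl. Qed.

Lemma qconjugate_sum q (I : Type) (r : seq I) (P : pred I) (F : I -> 'rV[R]_4) :
  qconjugate q (\sum_(i <- r | P i) F i) = \sum_(i <- r | P i) qconjugate q (F i).
Proof. by rewrite /qconjugate linear_sum /= qmul_suml. Qed.

(** Column [b] of [qrot q] is the imaginary quaternion q e_(b+1) q^-1, so a product of rotation
    matrices amounts to a composition of conjugations. *)
Lemma qrot_mul q q' : qrot (qmul q q') = qrot q *m qrot q'.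
Proof.
apply/matrixP => c b.
rewrite -[LHS](qim_lift (fun a => qrot (qmul q q') a b)) qrot_im.
rewrite qnormsq_mul invfM qconjugate_mul -scalerA -qconjugateZ -(qrot_im q' b) qim_sum.
rewrite qconjugate_sum scaler_sumr summxE [RHS]mxE; apply: eq_bigr => a _.
rewrite qconjugateZ scalerA mulrC -scalerA -(qrot_im q a) mxE qim_lift.
by rewrite mulrC.
Qed.

Lemma qrot_one : qrot qone = 1%:M.
Proof.
apply/matrixP => a b; rewrite -[LHS](qim_lift (fun a => qrot qone a b)) qrot_im.
rewrite -qnorm_sq qnorm_one expr1n invr1 scale1r /qconjugate qmul1l.
have -> : qconj qone = qone by apply: qextP; rewrite !qconjE !qoneE !oppr0.
by rewrite qmul1r !mxE /= (inj_eq lift_inj).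
Qed.

(* The relations of [admissible] transported by [qrep] below, which reverses
   products since endomorphisms act on rows. *)
Definition quaternion_frame (v : 'I_3 -> 'rV[R]_4) :=
  (forall a, qmul (v a) (v a) = - qone) /\ qmul (v 0) (qmul (v 1) (v 2)) = - qone.

Lemma qbasis_frame : quaternion_frame (fun a => qbasis R (lift 0 a)).
Proof.
have E (a : 'I_3) k : (k < 4)%N -> qbasis R (lift 0 a) 0 (inord k) = (k == a.+1)%:R.
  by move=> k4; rewrite mxE eqxx /= -val_eqE /= inordK // /bump /= add1n.
split=> [a|].
  apply: qextP; rewrite !qmulE ![(- qone) _ _]mxE !qoneE !E //.
  by case: a => -[|[|[|]]] //= _; split; ring.
by apply: qextP; rewrite !qmulE ![(- qone) _ _]mxE !qoneE !E //=; split; ring.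
Qed.

(** y |-> q y q^-1 is multiplicative ([M]) and fixes -1 ([N]), so it preserves all the relations. *)
Lemma quaternion_frame_conjugate q v : q != 0 -> quaternion_frame v ->
  quaternion_frame (fun a => (qnormsq q)^-1 *: qconjugate q (v a)).
Proof.
move=> q0 [v2 v3]; have n0 : qnormsq q != 0 by rewrite qnormsq_eq0.
have M x y : qmul ((qnormsq q)^-1 *: qconjugate q x) ((qnormsq q)^-1 *: qconjugate q y) =
    (qnormsq q)^-1 *: qconjugate q (qmul x y).
  rewrite qmulZl linearZ /= /qconjugate; congr (_ *: _).
  rewrite -(qmulA (qmul q x)) (qmulA (qconj q)) (qmulA (qconj q)) qconj_mulr.
  rewrite qmulZl qmul1l qmulZl qmulZr scalerA mulVf // scale1r.
  by rewrite !qmulA.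
have N : (qnormsq q)^-1 *: qconjugate q (- qone) = - qone.
  rewrite -scaleN1r qconjugateZ /qconjugate qmul1r qmul_conj !scalerA mulrCA.
  by rewrite mulVf // mulr1.
by split=> [a|]; rewrite !M ?v2 ?v3 N.
Qed.

(** * Quaternions acting on a tangent space through an admissible frame *)

Section Representation.
Variables (m : nat).
Implicit Types (I : 'I_3 -> 'M[R]_m).

Definition qrep I x : 'M[R]_m := x 0 0 *: 1%:M + \sum_a x 0 (lift 0 a) *: I a.

Lemma qrep_im I v : qrep I (qim v) = \sum_a v a *: I a.
Proof.
rewrite /qrep qim0 scale0r add0r; apply: eq_bigr => a _; by rewrite qim_lift.
Qed.

Lemma qrepE I x : qrep I x = x 0 (inord 0) *: 1%:M + x 0 (inord 1) *: I 0 +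
  x 0 (inord 2) *: I 1 + x 0 (inord 3) *: I 2.
Proof.
rewrite /qrep !big_ord_recl big_ord0 addr0 -inord0 !addrA.
by congr (_ + _ + _ + _); congr (_ *: _); try congr (x 0 _); try congr I;
   apply/val_inj; rewrite /= ?inordK.
Qed.

(** The table follows from the triple product by cancelling outer factors with the squares. As
    matrices act on rows, [I 2 *m I 1 = I 0] is the usual relation jk = i. *)
Lemma admissible_table I : admissible I ->
  [/\ I 2 *m I 1 = I 0, I 1 *m I 0 = I 2, I 0 *m I 2 = I 1,
      I 1 *m I 2 = - I 0 & (I 0 *m I 1 = - I 2) /\ (I 2 *m I 0 = - I 1)].
Proof.
move=> [sq c].
have CB : I 2 *m I 1 = I 0.
  have := congr1 (fun X => X *m I 0) c.
  by rewrite -mulmxA sq mulmxN mulmx1 mulNmx mul1mx => /oppr_inj.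
have BA : I 1 *m I 0 = I 2.
  have := congr1 (fun X => I 2 *m X) c.
  by rewrite !mulmxA sq !mulNmx mul1mx mulmxN mulmx1 => /oppr_inj.
have BC : I 1 *m I 2 = - I 0 by rewrite -BA mulmxA sq mulNmx mul1mx.
have CA : I 2 *m I 0 = - I 1 by rewrite -BA -mulmxA sq mulmxN mulmx1.
have AB : I 0 *m I 1 = - I 2 by rewrite -CB -mulmxA sq mulmxN mulmx1.
split => //.
by rewrite -{1}CB -mulmxA BC mulmxN CA opprK.
Qed.

Lemma qrep_mul I x y : admissible I -> qrep I (qmul x y) = qrep I y *m qrep I x.
Proof.
move=> aI; have [CB BA AC BC [AB CA]] := admissible_table aI.
have sq := aI.1.
rewrite !qrepE !qmulE !(mulmxDl, mulmxDr) -!(scalemxAl, scalemxAr) !(mulmx1, mul1mx).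
rewrite !sq CB BA AC BC AB CA.
apply/matrixP => i j; rewrite !mxE; ring.
Qed.

Lemma qrepZ I a x : qrep I (a *: x) = a *: qrep I x.
Proof.
rewrite /qrep scalerDr scaler_sumr mxE scalerA; congr (_ + _).
by apply: eq_bigr => b _; rewrite mxE scalerA.
Qed.

Lemma qrep_one I : qrep I qone = 1%:M.
Proof.
have q0 : qone 0 0 = 1 by rewrite -inord0 qoneE.
rewrite /qrep q0 scale1r big1 ?addr0 // => a _.
by rewrite [qone _ _]mxE eqxx /= scale0r.
Qed.

(** Multiplying by the image of the conjugate gives |x|^2 times the identity matrix; positive size
    of the matrices provides an entry from which |x|^2 = 0 is read off. *)
Lemma qrep_eq0 I x : (0 < m)%N -> admissible I -> qrep I x = 0 -> x = 0.
Proof.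
move=> m0 aI x0.
have := qrep_mul x (qconj x) aI; rewrite x0 mulmx0 qmul_conj qrepZ qrep_one.
move=> /matrixP/(_ (Ordinal m0) (Ordinal m0)); rewrite !mxE eqxx mulr1 => /eqP.
by rewrite qnormsq_eq0 => /eqP.
Qed.

Lemma qrep_inj I x y : (0 < m)%N -> admissible I -> qrep I x = qrep I y -> x = y.
Proof.
move=> m0 aI xy; apply/eqP; rewrite -subr_eq0; apply/eqP/(qrep_eq0 m0 aI).
have D u v : qrep I (u + v) = qrep I u + qrep I v.
  rewrite /qrep mxE scalerDl addrACA -big_split; congr (_ + _).
  by apply: eq_bigr => a _; rewrite mxE scalerDl.
by rewrite D -scaleN1r qrepZ scaleN1r xy subrr.
Qed.

Lemma admissible_qrep I v : admissible I -> quaternion_frame v ->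
  admissible (fun a => qrep I (v a)).
Proof.
move=> aI [v2 v3]; have N : qrep I (- qone) = - 1%:M.
  by rewrite -scaleN1r qrepZ qrep_one scaleN1r.
by split=> [a|]; rewrite -!qrep_mul // ?v2 ?v3 N.
Qed.

(** Injectivity of [qrep] pulls the relations between endomorphisms back to the coefficients. They
    then no longer refer to the point at which [I] is taken. *)
Lemma qrep_admissible I v : (0 < m)%N -> admissible I ->
  admissible (fun a => qrep I (v a)) -> quaternion_frame v.
Proof.
move=> m0 aI [v2 v3]; have N : qrep I (- qone) = - 1%:M.
  by rewrite -scaleN1r qrepZ qrep_one scaleN1r.
split=> [a|]; apply: (qrep_inj m0 aI); rewrite N !qrep_mul //.
Qed.

End Representation.
End QuaternionAlgebra.

(** * Volume forms *)

Section VolumeFormTheory.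
Variables (R : realType) (m : nat).
Implicit Types (mu : 'M[R]_m -> R) (B : 'M[R]_m).

Lemma volume_formZ c mu : c != 0 -> is_volume_form mu ->
  is_volume_form (fun A => c * mu A).
Proof.
move=> c0 [lin alt [A muA]]; split.
- move=> A' B C i b d rA rB rC; rewrite (lin A' B C i b d) //; ring.
- by move=> A' i j ij rA; rewrite (alt A' i j ij rA) mulr0.
- by exists A; rewrite mulf_neq0.
Qed.

Lemma volume_form_mulmx mu (C C' : 'M[R]_m) : C' *m C = 1%:M -> is_volume_form mu ->
  is_volume_form (fun A => mu (A *m C)).
Proof.
move=> CC [lin alt [A muA]]; split.
- move=> A' B D i b d rA rB rD; apply: (lin _ _ _ i); rewrite ?row_mul ?rA.
  + by rewrite mulmxDl -!scalemxAl.
  + by rewrite !row'Esub -!mul_rowsub_mx -!row'Esub rB.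
  + by rewrite !row'Esub -!mul_rowsub_mx -!row'Esub rD.
- by move=> A' i j ij rA; apply: (alt _ i j ij); rewrite !row_mul rA.
- by exists (A *m C'); rewrite -mulmxA CC mulmx1.
Qed.

Definition set_row B i (v : 'rV[R]_m) : 'M[R]_m :=
  \matrix_k (if k == i then v else row k B).

Lemma row_set_row B i v k : row k (set_row B i v) = if k == i then v else row k B.
Proof. by rewrite rowK. Qed.

Lemma row'_set_row B i v : row' i (set_row B i v) = row' i B.
Proof. by apply/matrixP => k l; rewrite !mxE (eq_sym _ i) (negbTE (neq_lift _ _)) mxE. Qed.

Lemma set_row_id B i : set_row B i (row i B) = B.
Proof. by apply/row_matrixP => k; rewrite row_set_row; case: eqP => // ->. Qed.

Lemma volume_form_expand mu B i : is_volume_form mu ->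
  mu B = \sum_j B i j * mu (set_row B i (delta_mx 0 j)).
Proof.
move=> [lin _ _].
have L a u v : mu (set_row B i (a *: u + v)) = a * mu (set_row B i u) + mu (set_row B i v).
  rewrite -[mu (set_row B i v)]mul1r; apply: (lin _ _ _ i); rewrite ?row'_set_row //.
  by rewrite !row_set_row eqxx scale1r.
have L0 : mu (set_row B i 0) = 0.
  by have := L (-1) 0 0; rewrite scaler0 addr0 mulN1r addNr.
have rB : row i B = \sum_j B i j *: delta_mx 0 j.
  by rewrite {1}[row i B]row_sum_delta; apply: eq_bigr => j _; rewrite mxE.
rewrite -{1}(set_row_id B i) rB.
elim/big_rec2 : _ => [//|j y v _ <-].
by rewrite L.
Qed.

End VolumeFormTheory.

Section SmoothVolumeForms.
Variables (R : realType) (m : nat).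
Implicit Types (mu : 'M[R]_m -> R).

Lemma volume_form_smooth mu (V : normedModType R) k (U : set V) (f : V -> 'M[R]_m) :
  open U -> is_volume_form mu -> Ck_on k U f -> Ck_on k U (fun x => mu (f x) : R^o).
Proof.
move=> oU vmu Cf.
(* Expanding row after row, [mu (f x)] becomes a polynomial in the entries of [f x]. *)
suff H r : (r <= m)%N -> forall g : V -> 'M[R]_m, Ck_on k U g ->
    (forall i : 'I_m, (r <= i)%N -> exists v, forall x, row i (g x) = v) ->
    Ck_on k U (fun x => mu (g x) : R^o).
  by apply: (H m) => // i; rewrite leqNgt ltn_ord.
elim: r => [|r IH] rm g Cg cg.
  have cg0 i : {v | forall x, row i (g x) = v} by apply: cid; exact: cg.
  pose B := \matrix_i projT1 (cg0 i).
  have -> : (fun x => mu (g x) : R^o) = (fun=> mu B).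
    apply/funext => x; congr mu; apply/row_matrixP => i; rewrite rowK.
    exact: (projT2 (cg0 i) x).
  exact: (@Ck_on_cst R V R^o).
(* The last row allowed to vary. After expansion it is replaced by fixed basis vectors, so only the
   rows of index below [r] still vary, as the induction hypothesis demands. *)
pose i0 := Ordinal rm.
have -> : (fun x => mu (g x) : R^o) =
    fun x => \sum_j (g x i0 j : R^o) *: (mu (set_row (g x) i0 (delta_mx 0 j)) : R^o).
  by apply/funext => x; rewrite (volume_form_expand (g x) i0 vmu).
apply: (@Ck_on_sum R V R^o) => // j _.
apply: (@Ck_onZ R V R^o) => //; first exact: Ck_on_coord.
apply: IH => [| |i]; first exact: ltnW.
  apply: Ck_on_matrix => // a b.
  case: (eqVneq a i0) => [->|ai].
    under eq_fun do rewrite mxE eqxx mxE.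
    exact: (@Ck_on_cst R V R^o).
  under eq_fun do rewrite mxE (negbTE ai) mxE.
  exact: Ck_on_coord.
move=> ri; case: (eqVneq i i0) => [->|ii0].
  by exists (delta_mx 0 j) => x; rewrite row_set_row eqxx.
have [|v Hv] := cg i.
  by rewrite ltn_neqAle ri andbT eq_sym; move: ii0; rewrite -val_eqE.
by exists v => x; rewrite row_set_row (negbTE ii0).
Qed.

Variable M : manifold R m.

(** The form [nu] has constant coefficients in the chart around [p]. In another chart its
    coefficient is [mu] evaluated at the transition Jacobian, which is smooth since [mu] is
    polynomial in the entries. *)
Lemma volume_form_transport (p : M) mu : is_volume_form mu ->
  exists nu : M -> 'M[R]_m -> R,
  [/\ smooth_vol (cdom (mchart p)) nu,
      forall q, cdom (mchart p) q -> is_volume_form (nu q) & nu p = mu].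
Proof.
move=> vmu; exists (fun q A => mu (A *m coord_coframe p q)); split.
- move=> c k; pose D := chart_image c (cdom (mchart p)).
  have oD : open D by exact/chart_image_open/open_cdom.
  have CJ : Ck_on k D (fun y => 'J (trans c p) y).
    by apply: smooth_on_jacobian => //; exact: smooth_trans.
  apply: (Ck_on_ext oD _ (volume_form_smooth oD vmu CJ)) => y /chart_imageP[Ey py cy].
  apply: (congr1 mu); exact: etrans (congr1 _ (esym Ey)) (esym (coord_frameM cy py)).
- by move=> q pq; apply: (volume_form_mulmx (C' := coord_frame p q)) => //; exact: coord_frameK.
- apply/funext => A; congr mu.
  have -> : coord_coframe p p = 1%:M by exact/jacobian_trans_id/mchart_mem.
  by rewrite mulmx1.
Qed.

End SmoothVolumeForms.

(** * The Swann bundle *)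

Section SwannAction.
Variables (R : realType) (m : nat) (M : manifold R m).
Implicit Types (t : swann_triple M) (Q : M -> {vspace 'M[R]_m}).

Lemma swann_act_mul t q q' : swann_act (swann_act t q) q' = swann_act t (qmul q q').
Proof.
rewrite /swann_act /=; congr (_, _, _).
  apply/seteqP; split=> nu /=.
    by move=> [_ [mu tmu <-] <-]; exists mu => //; apply/funext => A; rewrite qnorm_mul; ring.
  move=> [mu tmu <-]; exists (fun A => qnorm q * mu A); first by exists mu.
  by apply/funext => A; rewrite qnorm_mul; ring.
apply/funext => b; rewrite qrot_mul.
under eq_bigr do rewrite scaler_sumr.
rewrite exchange_big /=; apply: eq_bigr => c _.
by rewrite mxE scaler_suml; apply: eq_bigr => a _; rewrite scalerA mulrC.
Qed.

Lemma swann_act_one t : swann_act t (qone R) = t.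
Proof.
case: t => [[p S] I]; rewrite /swann_act /= qnorm_one qrot_one; congr (_, _, _).
  apply/seteqP; split=> nu /=.
    by move=> [mu Smu <-]; suff -> : (fun A => 1 * mu A) = mu by [];
      apply/funext => A; rewrite mul1r.
  by move=> Snu; exists nu => //; apply/funext => A; rewrite mul1r.
apply/funext => b; rewrite (bigD1 b) //= mxE eqxx scale1r big1 ?addr0 // => a ab.
by rewrite mxE (negbTE ab) scale0r.
Qed.

Lemma swann_act_frame t q b :
  (swann_act t q).2 b = qrep t.2 ((qnormsq q)^-1 *: qconjugate q (qbasis R (lift 0 b))).
Proof. by rewrite -qrot_im qrep_im. Qed.

Lemma swann_set_act Q t q : q != 0 -> swann_set Q t -> swann_set Q (swann_act t q).
Proof.
move=> q0 [[mu vmu tmu] [aI QI]]; split.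
  exists (fun A => qnorm q * mu A).
    by apply: volume_formZ => //; rewrite gt_eqF // qnorm_gt0.
  rewrite /= tmu; apply/seteqP; split=> nu /=.
    move=> [_ [->|->] <-]; [by left|right].
    by apply/funext => A; rewrite mulrN.
  move=> [->|->]; [by exists mu => //; left|].
  exists (fun A => - mu A); first by right.
  by apply/funext => A; rewrite mulrN.
split; last by move=> b; apply: memv_suml => a _; exact/memvZ/QI.
have -> : (swann_act t q).2 = fun b =>
    qrep t.2 ((qnormsq q)^-1 *: qconjugate q (qbasis R (lift 0 b))).
  by apply/funext => b; exact: swann_act_frame.
apply: admissible_qrep => //; apply: quaternion_frame_conjugate => //.
exact: qbasis_frame.
Qed.

Lemma span_frame (I : 'I_3 -> 'M[R]_m) A : A \in <<[seq I a | a : 'I_3]>>%VS ->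
  exists c : 'I_3 -> R, A = \sum_a c a *: I a.
Proof.
have -> : [seq I a | a : 'I_3] = [seq I a | a <- enum 'I_3] by [].
elim: (enum 'I_3) A (enum_uniq 'I_3) => [|a s IH] A /=.
  by rewrite span_nil memv0 => _ /eqP ->; exists (fun=> 0); rewrite big1 // => a _; rewrite scale0r.
move=> /andP[as_ us]; rewrite span_cons => /memv_addP[_ /vlineP[k ->] [B /IH]].
move=> /(_ us)[c ->] ->; exists (fun b => k *+ (b == a) + c b).
under [RHS]eq_bigr do rewrite scalerDl.
rewrite big_split /=; congr (_ + _).
rewrite (bigD1 a) //= eqxx big1 ?addr0 // => b ba.
by rewrite (negbTE ba) scale0r.
Qed.

(** The frame [J] at the point is a combination of the local frame [I0 p]. Its coefficients, read as
    imaginary quaternions [v a], are kept constant, and applied to [I0 q] they give the frame of the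
    section at [q]. *)
Lemma local_section_through Q t : (0 < m)%N -> almost_quaternionic Q -> swann_set Q t ->
  exists U mu I,
  [/\ open U, U t.1.1, smooth_vol U mu, forall p, U p -> is_volume_form (mu p) &
      local_admissible_frame Q U I /\ t = local_section mu I t.1.1].
Proof.
move=> m0 [_ aQ]; case: t => [[p S] J] [[mu0 vmu /= ->] [aJ QJ]] /=.
have [U0 [I0 [oU0 U0p [SI0 aI0] QI0]]] := aQ p.
have [mu [Smu vmu' mup]] := volume_form_transport p vmu.
have HJ a : {c : 'I_3 -> R | J a = \sum_b c b *: I0 p b}.
  by apply: cid; apply: span_frame; rewrite -QI0 //; exact: QJ.
pose v a := qim (projT1 (HJ a)).
have EJ a : J a = qrep (I0 p) (v a) by rewrite qrep_im; exact: projT2 (HJ a).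
(* Admissibility of [J] at the single point [p] becomes a statement about constants, and from there
   admissibility at every point of [U0]. *)
have vF : quaternion_frame v.
  apply: (qrep_admissible m0 (aI0 p U0p).1).
  by have -> : (fun a => qrep (I0 p) (v a)) = J by apply/funext => a; rewrite EJ.
pose U := U0 `&` cdom (mchart p).
exists U, mu, (fun q a => qrep (I0 q) (v a)); split.
- by apply: openI => //; exact: open_cdom.
- by split => //; exact: mchart_mem.
- by move=> c k; apply: Ck_on_sub (Smu c k); apply: chart_image_sub => q [].
- by move=> q [_]; exact: vmu'.
split.
  split=> [a c k|q [U0q _]].
    have oU : open (chart_image c U0) by exact: chart_image_open.
    apply: (Ck_on_sub (U := chart_image c U0)); first by apply: chart_image_sub => q [].
    apply: (Ck_on_ext (f := fun y => \sum_b projT1 (HJ a) b *: local_endo (fun q => I0 q b) c y)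
      oU).
      move=> y _; rewrite /local_endo qrep_im linear_sum /= mulmx_suml.
      by apply: eq_bigr => b _; rewrite -scalemxAr -scalemxAl.
    apply: Ck_on_sum => // b _.
    apply: (@Ck_on_linear _ _ _ _ _ _ ( *:%R (projT1 (HJ a) b))) => //.
      exact: scaler_continuous.
    exact: SI0.
  split; first exact: (admissible_qrep (aI0 q U0q).1 vF).
  move=> a; rewrite qrep_im; apply: memv_suml => b _; apply: memvZ.
  exact: (aI0 q U0q).2.
rewrite /local_section mup; congr (_, _, _).
by apply/funext => a; rewrite EJ.
Qed.

End SwannAction.

Section PadRow.
Variables (R : realType) (n k : nat).

Definition pad_row (v : 'rV[R]_k) : 'rV[R]_(n + k) := row_mx 0 v.

Lemma pad_row_linear : linear pad_row.
Proof. by move=> a u v; rewrite /pad_row scale_row_mx add_row_mx scaler0 addr0. Qed.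

HB.instance Definition _ := GRing.isLinear.Build R 'rV[R]_k 'rV[R]_(n + k) _
  pad_row pad_row_linear.

End PadRow.

(** * Local trivializations of the Swann bundle *)

Section SwannBundle.
Variables (R : realType) (m : nat) (M : manifold R m).
Variables (Q : M -> {vspace 'M[R]_m}) (P : manifold R (m + 4)) (tau : P -> swann_triple M).
Hypothesis m_gt0 : (0 < m)%N.
Hypothesis Q_aq : almost_quaternionic Q.
Hypothesis P_swann : is_swann_bundle tau Q.
Implicit Types (x y z : P) (q r : 'rV[R]_4).

Lemma tau_inj x y : tau x = tau y -> x = y.
Proof. by have [[_ inj _] _] := P_swann; apply: inj; rewrite in_setT. Qed.

Lemma tau_mem x : swann_set Q (tau x).
Proof. by have [[fun_tau _ _] _] := P_swann; exact: fun_tau. Qed.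

(** By surjectivity of [tau] a point with triple [t] exists, so the default [x] is not what is
    returned. *)
Lemma tau_pt x t : swann_set Q t -> tau (swann_pt tau x t) = t.
Proof.
move=> Qt; have [[_ _ surj] _] := P_swann; have [y _ yt] := surj _ Qt.
by apply: (xgetPex x (P := [set x | tau x = t])); exists y.
Qed.

Lemma swann_ptE x y t : tau y = t -> swann_pt tau x t = y.
Proof. by move=> yt; apply: tau_inj; rewrite tau_pt // -yt; exact: tau_mem. Qed.

Lemma tau_ract q x : q != 0 -> tau (swann_ract tau q x) = swann_act (tau x) q.
Proof. by move=> q0; apply: tau_pt; apply: swann_set_act => //; exact: tau_mem. Qed.

Lemma proj_ract q x : q != 0 -> swann_proj tau (swann_ract tau q x) = swann_proj tau x.
Proof. by move=> q0; rewrite /swann_proj tau_ract. Qed.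

Lemma open_neq0 n : open [set v : 'rV[R]_n | v != 0].
Proof.
have -> : [set v : 'rV[R]_n | v != 0] =
    [set: 'rV[R]_n] `&` (fun v => `|v|) @^-1` [set a : R | 0 < a].
  by rewrite setTI; apply/seteqP; split=> v /=; rewrite normr_gt0.
apply: open_preimage_on; [exact: openT| |exact: open_gt].
by move=> v _; exact: norm_continuous.
Qed.

(* The trivialization [T] around [x] defined by a section [s] with [x = s q]:
   [W] is a neighbourhood of the parameters of [x] and [g] inverts [T], read in
   the chart of [x]. *)
Record local_triv (s : M -> swann_triple M) x q (T : 'rV[R]_(m + 4) -> P)
    (W : set 'rV[R]_(m + 4)) (g : 'rV[R]_(m + 4) -> 'rV[R]_(m + 4)) : Prop := LocalTriv {
  triv_open : open W;
  triv_mem : W (row_mx (cmap (mchart (swann_proj tau x)) (swann_proj tau x)) q);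
  triv_center : T (row_mx (cmap (mchart (swann_proj tau x)) (swann_proj tau x)) q) = x;
  triv_dom : forall v, W v -> cdom (mchart x) (T v);
  triv_base : forall v, W v -> chart_image (swann_proj tau x) setT (lsubmx v);
  triv_neq0 : forall v, W v -> rsubmx v != 0;
  triv_tau : forall v, W v ->
    tau (T v) = swann_act (s (cinv (mchart (swann_proj tau x)) (lsubmx v))) (rsubmx v);
  triv_smooth : smooth_on W (cmap (mchart x) \o T);
  triv_open_img : open ((cmap (mchart x) \o T) @` W);
  triv_smooth_inv : smooth_on ((cmap (mchart x) \o T) @` W) g;
  trivK : forall v, W v -> g ((cmap (mchart x) \o T) v) = v;
  triv_base_s : forall p, (s p).1.1 = p
}.

Lemma local_triv_exists U mu (I : M -> 'I_3 -> 'M[R]_m) x q :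
  open U -> U (swann_proj tau x) -> smooth_vol U mu ->
  (forall p, U p -> is_volume_form (mu p)) -> local_admissible_frame Q U I ->
  q != 0 -> tau x = swann_act (local_section mu I (swann_proj tau x)) q ->
  exists T W g, local_triv (local_section mu I) x q T W g.
Proof.
move=> oU Ux Smu vmu fI q0 xq; have [_ /(_ x U mu I q oU Ux Smu vmu fI q0 xq)] := P_swann.
set w0 := row_mx _ q; set T := swann_trivialization tau mu I x => -[W [g]].
have Tw0 : T w0 = x.
  apply: swann_ptE; rewrite row_mxKl row_mxKr cmapK //; exact: mchart_mem.
rewrite Tw0; set f := cmap (mchart x) \o T => -[[oW Ww0] dW Cf [ofW Cg] gK].
pose c := swann_proj tau x.
(* Shrinking keeps the base point in [U], where the section takes values in the bundle, and the
   fibre coordinate nonzero, so that the triple s(p) q is attained by a point of [P]. *)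
pose W' := (W `&` lsubmx @^-1` chart_image c U) `&` rsubmx @^-1` [set q | q != 0].
have cl : continuous (@lsubmx R 1 m 4).
  exact: (@matrix_linear_continuous R 1 (m + 4) _ (@lsubmx R 1 m 4)).
have cr : continuous (@rsubmx R 1 m 4).
  exact: (@matrix_linear_continuous R 1 (m + 4) _ (@rsubmx R 1 m 4)).
have oW' : open W'.
  apply: open_preimage_on; last exact: open_neq0.
    apply: open_preimage_on; [exact: oW|by move=> v _; exact: cl|exact: chart_image_open].
  by move=> v _; exact: cr.
have sW : W' `<=` W by move=> v [[]].
have sfW : f @` W' `<=` f @` W by move=> y [v /sW Wv <-]; exists v.
exists T, W', g; split.
- exact: oW'.
- split; last by rewrite /= row_mxKr.
  by split => //=; rewrite row_mxKl; apply: mem_chart_image => //; exact: mchart_mem.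
- exact: Tw0.
- by move=> v /sW; exact: dW.
- by move=> v [[_ /= lv] _]; apply: chart_image_sub lv.
- by move=> v [_].
- move=> v [[_ /= /chart_imageP[_ Uv _]] /= rv].
  apply: tau_pt; apply: swann_set_act => //; split; last exact: fI.2.
  by exists (mu (cinv (mchart c) (lsubmx v))) => //; exact: vmu.
- by move=> k; apply: Ck_on_sub (Cf k).
(* The image of the smaller set is a preimage under the continuous inverse [g], hence open. *)
- have -> : f @` W' = (f @` W) `&` g @^-1` W'.
    apply/seteqP; split=> [y [v W'v <-]|y [[v Wv <-]]] /=.
      by split; [exists v => //; exact: sW|rewrite gK //; exact: sW].
    by rewrite gK // => W'v; exists v.
  apply: open_preimage_on; [exact: ofW| |exact: oW'].
  by move=> y; exact: (smooth_on_continuous Cg).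
- by move=> k; apply: Ck_on_sub (Cg k).
- by move=> v /sW; exact: gK.
- by [].
Qed.

(** A section through [x] itself places [x] at fibre coordinate 1. *)
Lemma local_triv_one x : exists s T W g, local_triv s x (qone R) T W g.
Proof.
have [U [mu [I [oU Ux Smu vmu [fI tx]]]]] := local_section_through m_gt0 Q_aq (tau_mem x).
have [T [W [g H]]] := local_triv_exists oU Ux Smu vmu fI (qone_neq0 R)
  (etrans tx (esym (swann_act_one _))).
by exists (local_section mu I), T, W, g.
Qed.

Section LocalTriv.
Variables (s : M -> swann_triple M) (x : P) (q0 : 'rV[R]_4).
Variables (T : 'rV[R]_(m + 4) -> P) (W : set 'rV[R]_(m + 4)).
Variable (g : 'rV[R]_(m + 4) -> 'rV[R]_(m + 4)).
Hypothesis tr : local_triv s x q0 T W g.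
Let c := swann_proj tau x.
Let f := cmap (mchart x) \o T.

Lemma triv_cinv v : W v -> cinv (mchart x) (f v) = T v.
Proof. by move=> Wv; rewrite /f /= cmapK //; exact: (triv_dom tr). Qed.

Lemma triv_img (y : 'rV[R]_(m + 4)) : (f @` W) y ->
  [/\ W (g y), f (g y) = y, cinv (mchart x) y = T (g y) & cdom (mchart x) (T (g y))].
Proof.
move=> [v Wv <-]; rewrite (trivK tr Wv) triv_cinv //.
by split => //; exact: (triv_dom tr).
Qed.

Lemma triv_proj v : W v -> swann_proj tau (T v) = cinv (mchart c) (lsubmx v).
Proof. by move=> Wv; rewrite /swann_proj (triv_tau tr Wv) /= (triv_base_s tr). Qed.

Lemma triv_diff v : W v -> differentiable f v.
Proof. exact: smooth_on_diff (triv_smooth tr). Qed.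

Lemma triv_inv_diff v : W v -> differentiable g (f v).
Proof. by move=> Wv; apply: (smooth_on_diff (triv_smooth_inv tr)); exists v. Qed.

Lemma triv_jacobianK v : W v -> 'J f v *m 'J g (f v) = 1%:M.
Proof.
move=> Wv; apply: etrans (esym (jacobian_comp (triv_diff Wv) (triv_inv_diff Wv))) _.
apply: etrans (jacobian_id v).
apply: jacobian_near; last exact: (differentiable_comp (triv_diff Wv) (triv_inv_diff Wv)).
by apply: (open_eq_near (triv_open tr) Wv) => u Wu; exact: (trivK tr).
Qed.

Lemma triv_jacobianVK v : W v -> 'J g (f v) *m 'J f v = 1%:M.
Proof. by move=> Wv; apply: mulmx1C; exact: triv_jacobianK. Qed.

Lemma triv_proj_repE (y : 'rV[R]_(m + 4)) : (f @` W) y ->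
  chart_rep (swann_proj tau) x c y = lsubmx (g y).
Proof.
move=> fy; have [Wgy _ Ty _] := triv_img fy.
have [E _ _] := chart_imageP (triv_base tr Wgy).
by rewrite /chart_rep /= Ty triv_proj.
Qed.

Lemma triv_dom_proj v : W v -> cdom (mchart c) (swann_proj tau (T v)).
Proof. by move=> Wv; have [_ _] := chart_imageP (triv_base tr Wv); rewrite triv_proj. Qed.

Lemma triv_proj_rep : smooth_rep (swann_proj tau) x c (f @` W).
Proof.
split; first exact: (triv_open_img tr).
  move=> y fy; have [Wgy Ey Ty dT] := triv_img fy.
  rewrite -Ey; apply: mem_chart_image => //=.
  exact: triv_dom_proj.
move=> k; have Cg : Ck_on k (f @` W) (fun u => @lsubmx R 1 m 4 (g u)).
  apply: (Ck_on_mlinear (@lsubmx R 1 m 4)); first exact: (triv_open_img tr).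
  exact: (triv_smooth_inv tr k).
refine (Ck_on_ext (triv_open_img tr) _ Cg) => u fu.
exact/esym/triv_proj_repE.
Qed.

(** In the coordinates of the trivialization the projection is the linear map [lsubmx], which is its
    own differential. *)
Lemma triv_jacobian_proj v (u : 'rV[R]_(m + 4)) : W v ->
  u *m 'J f v *m 'J (chart_rep (swann_proj tau) x c) (f v) = lsubmx u.
Proof.
move=> Wv.
have fv : (f @` W) (f v) by exists v.
have dp := smooth_on_diff (let: And3 _ _ C := triv_proj_rep in C) fv.
rewrite -mulmxA; apply: etrans (congr1 (mulmx u) (esym (jacobian_comp (triv_diff Wv) dp))) _.
have E : 'J (chart_rep (swann_proj tau) x c \o f) v = lin1_mx (@lsubmx R 1 m 4).
  apply: etrans (jacobian_linear (@lsubmx R 1 m 4) v).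
  apply: jacobian_near; last exact: (differentiable_comp (triv_diff Wv) dp).
  apply: (open_eq_near (triv_open tr) Wv) => z Wz /=.
  have fz : (f @` W) (f z) by exists z.
  by rewrite (triv_proj_repE fz) (trivK tr Wz).
by rewrite E mul_rV_lin1.
Qed.

(** The row [z *m coord_coframe x (T v) *m 'J g (f v)] holds the components of [z] in the
    coordinates (p, q), and the projection retains its p-part. The remaining factor, a frame of the
    base, is invertible. *)
Lemma triv_vertical v (z : 'rV[R]_(m + 4)) : W v -> vertical (swann_proj tau) (T v) z <->
  lsubmx (z *m coord_coframe x (T v) *m 'J g (f v)) = 0.
Proof.
move=> Wv; have dTv := triv_dom tr Wv.
have fv : (f @` W) (cmap (mchart x) (T v)) by exists v.
rewrite /vertical /= (tangent_mapE triv_proj_rep dTv fv) -/(f v).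
have E : z *m coord_coframe x (T v) *m 'J (chart_rep (swann_proj tau) x c) (f v) =
    lsubmx (z *m coord_coframe x (T v) *m 'J g (f v)).
  have E0 : z *m coord_coframe x (T v) *m 'J g (f v) *m 'J f v = z *m coord_coframe x (T v).
    apply: etrans (esym (mulmxA _ _ _)) _.
    exact: etrans (congr1 (mulmx _) (triv_jacobianVK Wv)) (mulmx1 _).
  apply: etrans (triv_jacobian_proj (z *m coord_coframe x (T v) *m 'J g (f v)) Wv).
  exact: (congr1 (fun A => A *m 'J (chart_rep (swann_proj tau) x c) (f v)) (esym E0)).
rewrite -E !mulmxA; split => [H|-> ]; last by rewrite mul0mx.
have := congr1 (fun A => A *m coord_coframe c (swann_proj tau (T v))) H.
by rewrite /= -mulmxA (coord_frameK (triv_dom_proj Wv)) mulmx1 mul0mx.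
Qed.

End LocalTriv.

End SwannBundle.

Lemma coord_frame_id (R : realType) (m : nat) (M : manifold R m) (p : M) :
  coord_frame p p = 1%:M.
Proof. exact/jacobian_trans_id/mchart_mem. Qed.

Section QuaternionOrbit.
Variables (R : realType) (m : nat) (l : 'rV[R]_m) (a : 'rV[R]_4).

Definition qorbit (r : 'rV[R]_4) : 'rV[R]_(m + 4) := row_mx l (qmul a r).

Lemma qorbitE r : qorbit r = row_mx l 0 + pad_row m (qmul a r).
Proof. by rewrite /qorbit /pad_row add_row_mx addr0 add0r. Qed.

Lemma smooth_qorbit (U : set 'rV[R]_4) : open U -> smooth_on U qorbit.
Proof.
move=> oU k; pose L : {linear 'rV[R]_4 -> 'rV[R]_(m + 4)} := @pad_row R m 4 \o qmul a.
have -> : qorbit = (fun r => row_mx l 0 + L r) by apply/funext => r; exact: qorbitE.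
apply: Ck_onD => //; first exact: Ck_on_cst.
apply: (Ck_on_mlinear L (f := id)) => //; exact: smooth_on_id.
Qed.

Lemma qorbit_continuous r : {for r, continuous qorbit}.
Proof. exact: (smooth_on_continuous (smooth_qorbit openT)). Qed.

Lemma qorbit_diff r : differentiable qorbit r.
Proof. exact: (smooth_on_diff (smooth_qorbit openT)). Qed.

Lemma diff_qorbit r u : 'd qorbit r u = pad_row m (qmul a u).
Proof.
pose L : {linear 'rV[R]_4 -> 'rV[R]_(m + 4)} := @pad_row R m 4 \o qmul a.
have cL := @matrix_linear_continuous R 1 4 _ L.
have E : qorbit = cst (row_mx l 0) + L by apply/funext => z; exact: qorbitE.
have dL := linear_differentiable r cL.
have dc := differentiable_cst (row_mx l 0 : 'rV[R]_(m + 4)) r.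
rewrite E; apply: etrans (congr1 (fun h : 'rV[R]_4 -> 'rV[R]_(m + 4) => h u) (diffD dc dL)) _.
have E1 : 'd (cst (row_mx l 0 : 'rV[R]_(m + 4))) r u = 0 :=
  congr1 (fun h : 'rV[R]_4 -> 'rV[R]_(m + 4) => h u) (diff_cst (row_mx l 0) r).
have E2 : 'd L r u = L u := congr1 (fun h : 'rV[R]_4 -> 'rV[R]_(m + 4) => h u) (diff_lin r cL).
by apply: etrans (congr2 +%R E1 E2) _; rewrite add0r.
Qed.

End QuaternionOrbit.

(** * Fundamental fields, projection, action and orbits in a trivialization *)

Section SwannGeometry.
Variables (R : realType) (m : nat) (M : manifold R m).
Variables (Q : M -> {vspace 'M[R]_m}) (P : manifold R (m + 4)) (tau : P -> swann_triple M).
Hypothesis m_gt0 : (0 < m)%N.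
Hypothesis Q_aq : almost_quaternionic Q.
Hypothesis P_swann : is_swann_bundle tau Q.

Section InTriv.
Variables (s : M -> swann_triple M) (x : P) (q0 : 'rV[R]_4).
Variables (T : 'rV[R]_(m + 4) -> P) (W : set 'rV[R]_(m + 4)).
Variable (g : 'rV[R]_(m + 4) -> 'rV[R]_(m + 4)).
Hypothesis tr : local_triv tau s x q0 T W g.
Let f := cmap (mchart x) \o T.

Lemma ract_triv v r : W v -> W (qorbit (lsubmx v) (rsubmx v) r) ->
  swann_ract tau r (T v) = T (qorbit (lsubmx v) (rsubmx v) r).
Proof.
move=> Wv Wr; apply: (swann_ptE P_swann).
by rewrite (triv_tau tr Wr) (triv_tau tr Wv) row_mxKl row_mxKr swann_act_mul.
Qed.

(** For r near 1 the orbit of [T v] is r |-> T (p, q r), affine inside [T]. The chain rule yields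
    the three factors, the last one because the field is expressed in the preferred chart of [T v]
    rather than in that of [x]. *)
Lemma fundamental_field_triv a v : W v -> fundamental_field tau a (T v) =
  pad_row m (qmul (rsubmx v) (qbasis R a)) *m 'J f v *m coord_frame x (T v).
Proof.
move=> Wv; pose O := qorbit (lsubmx v) (rsubmx v).
have O1 : O (qone R) = v by rewrite /O /qorbit qmul1r hsubmxK.
have dO : differentiable O (qone R) by exact: qorbit_diff.
have df : differentiable f (O (qone R)) by rewrite O1; exact: (triv_diff tr).
have xT : cdom (mchart x) (T v) by exact: (triv_dom tr).
have dt : differentiable (trans x (T v)) (f (O (qone R))).
  by rewrite O1; apply: trans_differentiable => //; exact: mchart_mem.
have dfO := differentiable_comp dO df.
have E : 'd (trans x (T v) \o (f \o O)) (qone R) (qbasis R a) =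
    pad_row m (qmul (rsubmx v) (qbasis R a)) *m 'J f v *m coord_frame x (T v).
  apply: etrans (diff_compE _ dfO dt) _.
  apply: etrans (esym (jacobianE _ _ _)) _.
  apply: etrans (congr1 (fun w => w *m _) (diff_compE _ dO df)) _.
  rewrite diff_qorbit -jacobianE /= O1; reflexivity.
apply: etrans _ E; apply: diff_near; last exact: (differentiable_comp dfO dt).
pose D := [set: 'rV[R]_4] `&` O @^-1` W.
have oD : open D.
  apply: open_preimage_on; [exact: openT| |exact: (triv_open tr)].
  by move=> r _; exact: qorbit_continuous.
have D1 : D (qone R) by split => //; rewrite /= O1.
apply: (open_eq_near oD D1) => r [_ WOr].
rewrite (ract_triv Wv WOr) /= -/(f (O r)) /trans /=.
by rewrite (triv_cinv tr).
Qed.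

Lemma local_fundamental_field a (u : 'rV[R]_(m + 4)) : (f @` W) u ->
  local_field (fundamental_field tau a) x u =
  pad_row m (qmul (rsubmx (g u)) (qbasis R a)) *m 'J f (g u).
Proof.
move=> fu; have [Wgu _ Eu xT] := triv_img tr fu.
rewrite /local_field Eu (fundamental_field_triv _ Wgu).
apply: etrans (esym (mulmxA _ _ _)) _.
by apply: etrans (congr1 (mulmx _) (coord_frameK xT)) (mulmx1 _).
Qed.

Lemma sum_fundamental_field (h : 'I_4 -> R) v : W v ->
  \sum_a h a *: fundamental_field tau a (T v) =
  pad_row m (qmul (rsubmx v) (\row_a h a)) *m 'J f v *m coord_frame x (T v).
Proof.
move=> Wv; rewrite [\row_a h a]row_sum_delta !linear_sum /= !mulmx_suml.
apply: eq_bigr => a _; rewrite mxE (fundamental_field_triv _ Wv).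
by rewrite linearZ /= linearZ /= -!scalemxAl.
Qed.

(** Passing to the coordinates (p, q) and back is the identity, as the Jacobians of [f] and [g] and
    the frame and coframe are mutually inverse; vertical vectors are those with zero p-part. *)
Lemma vertical_pad v (z : 'rV[R]_(m + 4)) : W v ->
  vertical (swann_proj tau) (T v) z <->
  exists y : 'rV[R]_4, z = pad_row m y *m 'J f v *m coord_frame x (T v).
Proof.
move=> Wv; have xT := triv_dom tr Wv.
have JV := triv_jacobianVK tr Wv; have JK := triv_jacobianK tr Wv.
rewrite (triv_vertical tr z Wv) -/f.
split=> [l0|[y ->]].
  set u := z *m _ *m _ in l0.
  exists (rsubmx u).
  have -> : pad_row m (rsubmx u) = u by rewrite /pad_row -l0 hsubmxK.
  apply/esym; rewrite /u.
  apply: etrans (congr1 (fun A => A *m _) (etrans (esym (mulmxA _ _ _))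
    (etrans (congr1 (mulmx _) JV) (mulmx1 _)))) _.
  apply: etrans (esym (mulmxA _ _ _)) _.
  by apply: etrans (congr1 (mulmx _) (coord_coframeK xT)) (mulmx1 _).
apply: etrans (congr1 lsubmx (congr1 (fun A => A *m _) (etrans (esym (mulmxA _ _ _))
  (etrans (congr1 (mulmx _) (coord_frameK xT)) (mulmx1 _))))) _.
apply: etrans (congr1 lsubmx (etrans (esym (mulmxA _ _ _))
  (etrans (congr1 (mulmx _) JK) (mulmx1 _)))) _.
by rewrite row_mxKl.
Qed.

Lemma distribution_span_triv v : W v ->
  distribution_span (fundamental_field tau) (T v) = vertical (swann_proj tau) (T v).
Proof.
move=> Wv; apply/seteqP; split=> z.
  move=> [h ->]; apply/(vertical_pad _ Wv).
  by exists (qmul (rsubmx v) (\row_a h a)); exact: sum_fundamental_field.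
move=> /(vertical_pad _ Wv)[y ->].
exists (fun a => qmul (qinv (rsubmx v)) y 0 a).
rewrite sum_fundamental_field //.
have -> : \row_a qmul (qinv (rsubmx v)) y 0 a = qmul (qinv (rsubmx v)) y.
  by apply/rowP => a; rewrite mxE.
by rewrite qmulKV //; exact: (triv_neq0 tr).
Qed.

End InTriv.

Lemma fundamental_span : distribution_span (fundamental_field tau) = vertical (swann_proj tau).
Proof.
apply/funext => x; have [s [T [W [g tr]]]] := local_triv_one m_gt0 Q_aq P_swann x.
by rewrite -{1 2}(triv_center tr); exact: (distribution_span_triv tr (triv_mem tr)).
Qed.

Lemma smooth_swann_proj : smooth_mapping (swann_proj tau).
Proof.
move=> x; have [s [T [W [g tr]]]] := local_triv_one m_gt0 Q_aq P_swann x.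
exists x, (swann_proj tau x), ((cmap (mchart x) \o T) @` W); split.
- exact: mchart_mem.
- exact: (triv_proj_rep tr).
- by eexists; [exact: (triv_mem tr)|rewrite /= (triv_center tr)].
Qed.

Lemma row_full_tangent_proj x : row_full (tangent_map (swann_proj tau) x).
Proof.
have [s [T [W [g tr]]]] := local_triv_one m_gt0 Q_aq P_swann x.
have Ww := triv_mem tr; have Tw := triv_center tr.
move: Ww Tw; set w0 := row_mx _ _ => Ww Tw.
have fw : ((cmap (mchart x) \o T) @` W) (cmap (mchart x) x).
  by eexists; [exact: Ww|rewrite /= Tw].
(* The witness is the horizontal lift of the trivialization: a tangent vector u of the base goes to
   (u, 0). *)
apply/row_fullP; exists (row_mx 1%:M 0 *m 'J (cmap (mchart x) \o T) w0).
apply/row_matrixP => i; rewrite !row_mul row_row_mx row1.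
rewrite (tangent_mapE (triv_proj_rep tr) (mchart_mem x) fw).
rewrite [coord_coframe x x]coord_frame_id mul1mx coord_frame_id mulmx1.
have := triv_jacobian_proj tr (row_mx (delta_mx 0 i) (row i 0)) Ww.
rewrite row_mxKl => E; apply: etrans E.
by rewrite /= Tw.
Qed.

Lemma smooth_fundamental_field a : smooth_field setT (fundamental_field tau a).
Proof.
apply: smooth_field_local => x _.
have [s [T [W [g tr]]]] := local_triv_one m_gt0 Q_aq P_swann x.
have oB := triv_open_img tr; set B := _ @` W in oB.
exists x, B; split => //.
- exact: mchart_mem.
- by eexists; [exact: (triv_mem tr)|rewrite /= (triv_center tr)].
move=> k.
have Cg : Ck_on k B g by exact: (triv_smooth_inv tr k).
have CJ : Ck_on k B (fun u => 'J (cmap (mchart x) \o T) (g u)).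
  apply: (Ck_on_comp oB (triv_open tr) _ Cg (smooth_on_jacobian (triv_open tr) (triv_smooth tr) k)).
  by move=> u /(triv_img tr)[].
have CL : Ck_on k B (fun u => pad_row m (qmul (rsubmx (g u)) (qbasis R a))).
  have Cr : Ck_on k B (fun u => rsubmx (g u) : 'rV[R]_4).
    exact: (Ck_on_mlinear (@rsubmx R 1 m 4) oB Cg).
  pose LM := GRing.isLinear.Build _ _ _ _ _ (qmul_linearl (qbasis R a)).
  pose L : {linear 'rV[R]_4 -> 'rV[R]_4} := HB.pack (fun y => qmul y (qbasis R a)) LM.
  exact: (Ck_on_mlinear (@pad_row R m 4) oB (Ck_on_mlinear L oB Cr)).
apply: (Ck_on_ext oB _ (Ck_on_mulmx oB CL CJ)) => u Bu.
exact: (esym (local_fundamental_field tr a Bu)).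
Qed.

Definition row_qmul (q : 'rV[R]_4) (v : 'rV[R]_(m + 4)) : 'rV[R]_(m + 4) :=
  row_mx (lsubmx v) (qmul (rsubmx v) q).

Lemma row_qmul_linear q : linear (row_qmul q).
Proof.
move=> a u v; rewrite /row_qmul scale_row_mx add_row_mx.
by rewrite linearP [rsubmx _]linearP qmul_linearl.
Qed.

HB.instance Definition _ q := GRing.isLinear.Build R 'rV[R]_(m + 4) 'rV[R]_(m + 4) _
  (row_qmul q) (row_qmul_linear q).

(** One section s serves at both ends: s(p) = x gives coordinates around x centred at fibre
    coordinate 1, and s(p) q = x q gives coordinates around x q centred at q. Between them the
    action is the linear map [row_qmul q]. *)
Lemma smooth_swann_ract q : q != 0 -> smooth_mapping (swann_ract tau q).
Proof.
move=> q_neq0 x.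
have [U [mu [I [oU Ux Smu vmu [fI tx]]]]] :=
  local_section_through m_gt0 Q_aq (tau_mem P_swann x).
have [T [W [g tr]]] := local_triv_exists P_swann oU Ux Smu vmu fI (qone_neq0 R)
  (etrans tx (esym (swann_act_one _))).
pose y := swann_ract tau q x.
have yx : swann_proj tau y = swann_proj tau x by exact: (proj_ract P_swann).
have Uy : U (swann_proj tau y) by rewrite yx.
have ty : tau y = swann_act (local_section mu I (swann_proj tau y)) q.
  by rewrite (tau_ract P_swann) // yx tx.
have [T' [W' [g' tr']]] := local_triv_exists P_swann oU Uy Smu vmu fI q_neq0 ty.
pose f := cmap (mchart x) \o T; pose f' := cmap (mchart y) \o T'.
have cK : continuous (row_qmul q) by exact: (@matrix_linear_continuous R 1 (m + 4) _ (row_qmul q)).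
have oW1 : open (W `&` row_qmul q @^-1` W').
  apply: open_preimage_on; [exact: (triv_open tr)| |exact: (triv_open tr')].
  by move=> v _; exact: cK.
pose B := (f @` W) `&` g @^-1` (W `&` row_qmul q @^-1` W').
have oB : open B.
  apply: open_preimage_on; [exact: (triv_open_img tr)| |exact: oW1].
  by move=> u; exact: (smooth_on_continuous (triv_smooth_inv tr)).
have TT v : W v -> W' (row_qmul q v) -> swann_ract tau q (T v) = T' (row_qmul q v).
  move=> Wv Wv'; apply: (swann_ptE P_swann).
  rewrite (triv_tau tr' Wv') (triv_tau tr Wv) row_mxKl row_mxKr yx.
  by rewrite swann_act_mul.
exists x, y, B; split; first exact: mchart_mem.
  split; first exact: oB.
    move=> u [/(triv_img tr)[_ Eu Tu xT] [Wgu Wu]].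
    rewrite -Eu /=; apply: mem_chart_image => //=.
    by rewrite TT //; exact: (triv_dom tr').
  move=> k.
  have CK : Ck_on k B (fun u => row_qmul q (g u)).
    apply: (Ck_on_mlinear (row_qmul q)) => //.
    by apply: Ck_on_sub (triv_smooth_inv tr k) => u [].
  apply: (Ck_on_ext oB _ (Ck_on_comp oB (triv_open tr') _ CK (triv_smooth tr' k))).
    move=> u [fu [Wgu Wu]]; have [_ _ Eu _] := triv_img tr fu.
    by rewrite /chart_rep /= Eu TT.
  by move=> u [_ [_ Wu]].
have Ww := triv_mem tr; have Tw := triv_center tr.
move: Ww Tw; set w0 := row_mx _ _ => Ww Tw.
have fw : f w0 = cmap (mchart x) x by rewrite /f /= Tw.
rewrite -fw; split; first by exists w0.
rewrite /= (trivK tr Ww); split => //=.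
rewrite /row_qmul row_mxKl row_mxKr qmul1l -yx.
exact: (triv_mem tr').
Qed.

(** Describes the orbit map near [q1] in a trivialization centred at its value there. The same
    invertible matrix [A] presents both the tangent space of the orbit and the vertical space, which
    makes them comparable. *)
Lemma orbit_param (p : P) (q1 : 'rV[R]_4) : q1 != 0 ->
  let F := fun q => swann_ract tau q p in
  exists (A : 'M[R]_(m + 4)) (V : set 'rV[R]_4),
  [/\ A \in unitmx, open V /\ V q1,
      (forall r, V r -> cdom (mchart (F q1)) (F r)) /\ smooth_on V (cmap (mchart (F q1)) \o F),
      forall u, u *m tangent_param F q1 = pad_row m (qmul (qinv q1) u) *m A &
      forall z, vertical (swann_proj tau) (F q1) z <->
        exists y : 'rV[R]_4, z = pad_row m y *m A].
Proof.
move=> q1_neq0 F; set y := F q1.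
have [s [T [W [g tr]]]] := local_triv_one m_gt0 Q_aq P_swann y.
have Ww := triv_mem tr; have Tw := triv_center tr.
have Ev := vertical_pad tr; have JK := triv_jacobianK tr Ww; have df := triv_diff tr Ww.
have ts := triv_tau tr Ww.
rewrite row_mxKl row_mxKr swann_act_one Tw in ts.
(* With y = p q1 the orbit is p r = y (q1^-1 r), so in coordinates centred at y the fibre coordinate
   is q1^-1 r, equal to 1 at r = q1. *)
pose E := qorbit (cmap (mchart (swann_proj tau y)) (swann_proj tau y)) (qinv q1).
have Eq1 : E q1 = row_mx (cmap (mchart (swann_proj tau y)) (swann_proj tau y)) (qone R).
  by rewrite /E /qorbit -{2}(qmul1r q1) qmulVK.
pose f := cmap (mchart y) \o T.
rewrite -Eq1 in Ww Tw JK df.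
exists ('J f (E q1)), ([set: 'rV[R]_4] `&` E @^-1` W).
have FE r : W (E r) -> F r = T (E r).
  move=> Wr; apply: (swann_ptE P_swann).
  rewrite (triv_tau tr Wr) row_mxKl row_mxKr -ts (tau_ract P_swann) // swann_act_mul.
  by rewrite qmulKV.
have oV : open ([set: 'rV[R]_4] `&` E @^-1` W).
  apply: open_preimage_on; [exact: openT| |exact: (triv_open tr)].
  by move=> r _; exact: qorbit_continuous.
have Vq1 : ([set: 'rV[R]_4] `&` E @^-1` W) q1 by [].
have fE r : ([set: 'rV[R]_4] `&` E @^-1` W) r -> (f \o E) r = (cmap (mchart y) \o F) r.
  by move=> [_ Wr]; rewrite /= FE.
split.
- exact: (mulmx1_unit JK).1.
- by [].
- split; first by move=> r [_ Wr]; rewrite FE //; exact: (triv_dom tr).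
  move=> k; apply: (Ck_on_ext oV fE).
  apply: (Ck_on_comp oV (triv_open tr) _ (smooth_qorbit _ _ oV k) (triv_smooth tr k)).
  by move=> r [].
- move=> u; rewrite /tangent_param jacobianE.
  have dE : differentiable E q1 by exact: qorbit_diff.
  apply: etrans (diff_near u (open_eq_near oV Vq1 fE) (differentiable_comp dE df)) _.
  apply: etrans (diff_compE u dE df) _.
  apply: etrans (esym (jacobianE f _ _)) _.
  exact: (congr1 (fun w => w *m _) (diff_qorbit _ _ _ _)).
- move=> z; have := Ev (E q1) z Ww.
  by rewrite Tw coord_frame_id; under eq_exists do rewrite mulmx1.
Qed.

(** Integral manifolds are asked to be immersed, so the orbit map can be taken on the nonzero
    quaternions although q and -q act alike. Its differential is injective with vertical image
    because u |-> q^-1 u and [A] are invertible. *)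
Lemma integrable_vertical : integrable_distribution (vertical (swann_proj tau)).
Proof.
move=> p; exists 4, [set q : 'rV[R]_4 | q != 0], (fun q => swann_ract tau q p).
split.
- exact: open_neq0.
- move=> q /(orbit_param p)[A [V [_ oV [dV SV] _ _]]]; by exists V.
- exists (qone R); first exact: qone_neq0.
  by apply: (swann_ptE P_swann); rewrite swann_act_one.
- move=> q q_neq0; have [A [V [uA _ _ E _]]] := orbit_param p q_neq0.
  rewrite -kermx_eq0; apply/rowV0P => u /sub_kermxP; rewrite E => uA0.
  have /eqP := congr1 (fun w => w *m invmx A) uA0.
  rewrite /= mulmxK // mul0mx => /eqP/(congr1 rsubmx).
  rewrite row_mxKr linear0 => qu.
  by rewrite -(qmulKV u q_neq0) qu linear0.
- move=> q q_neq0; have [A [V [uA _ _ E Ev]]] := orbit_param p q_neq0.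
  apply/seteqP; split=> [z /Ev[y ->]|z [u _ <-]]; last by apply/Ev; rewrite E; eexists.
  by exists (qmul q y) => //; rewrite E qmulVK.
Qed.

End SwannGeometry.

(** * Rank and kernel of the pullback along a submersion *)

Section PullbackKernel.
Variables (R : realType) (k m : nat).
Implicit Types (A : 'M[R]_(k, m)) (B : 'M[R]_m).

Lemma nondegenerate_row_free B :
  (forall u, (forall v, form2_eval B u v = 0) -> u = 0) -> row_free B.
Proof.
move=> nB; rewrite -kermx_eq0; apply/rowV0P => u /sub_kermxP uB.
by apply: nB => v; rewrite /form2_eval uB mul0mx mxE.
Qed.

Lemma rank_congr A B : row_full A -> row_free B -> \rank (A *m B *m A^T) = m.
Proof.
move=> fA fB; rewrite mxrankMfree; last by rewrite /row_free mxrank_tr.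
by rewrite mxrankMfree //; exact/eqP.
Qed.

(** A left inverse [C] of [A] lifts every test vector [v] to [v *m C], so nondegeneracy of [B]
    applies to [u *m A]. *)
Lemma congr_kernel A B u : row_full A ->
  (forall u, (forall v, form2_eval B u v = 0) -> u = 0) ->
  (forall v, form2_eval (A *m B *m A^T) u v = 0) <-> u *m A = 0.
Proof.
move=> /row_fullP[C CA] nB; split=> [H|uA v]; last first.
  by rewrite form2_eval_mul uA /form2_eval !mul0mx mxE.
apply: nB => v; have := H (v *m C).
by rewrite form2_eval_mul -(mulmxA v) CA mulmx1.
Qed.

End PullbackKernel.

Section QuaternionSmooth.
Variables (R : realType) (V : normedModType R).

Lemma Ck_on_qmul k (U : set V) (f g : V -> 'rV[R]_4) : open U ->
  Ck_on k U f -> Ck_on k U g -> Ck_on k U (fun x => qmul (f x) (g x)).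
Proof.
move=> oU Cf Cg.
have -> : (fun x => qmul (f x) (g x)) =
    fun x => \sum_i (f x 0 i : R^o) *: qmul (delta_mx 0 i) (g x).
  apply/funext => x; rewrite {1}[f x]row_sum_delta qmul_suml.
  by apply: eq_bigr => i _; rewrite qmulZl.
apply: Ck_on_sum => // i _; apply: (Ck_onZ (f := fun x => f x 0 i : R^o)) => //.
  exact: Ck_on_coord.
exact: (Ck_on_mlinear (qmul (delta_mx 0 i)) oU Cg).
Qed.

Lemma qconj_linear : linear (@qconj R).
Proof. by move=> a x y; apply: qextP; rewrite !(qconjE, mxE); split; ring. Qed.

HB.instance Definition _ := GRing.isLinear.Build R 'rV[R]_4 'rV[R]_4 _
  (@qconj R) qconj_linear.

Lemma Ck_on_qinv k (U : set V) (f : V -> 'rV[R]_4) : open U ->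
  (forall x, U x -> f x != 0) -> Ck_on k U f -> Ck_on k U (fun x => qinv (f x)).
Proof.
move=> oU f0 Cf; apply: (Ck_onZ (f := fun x => (qnormsq (f x))^-1 : R^o)) => //.
  apply: Ck_onV => //; first by move=> x Ux; rewrite qnormsq_eq0; exact: f0.
  apply: (@Ck_on_sum R V R^o) => // i _.
  under eq_fun do rewrite expr2.
  by apply: (@Ck_onZ R V R^o) => //; exact: Ck_on_coord.
exact: (Ck_on_mlinear (@qconj R) oU Cf).
Qed.

End QuaternionSmooth.

Section FieldSpan.
Variables (R : realType) (m : nat) (M : manifold R m).

Lemma smooth_field_comb k (h : 'I_k -> M -> R) (Z : 'I_k -> M -> 'rV[R]_m) :
  (forall a, smooth_fun setT (h a)) -> (forall a, smooth_field setT (Z a)) ->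
  smooth_field setT (fun p => \sum_a h a p *: Z a p).
Proof.
move=> Sh SZ c j; have oT : open (chart_image c [set: M]) by exact/chart_image_open/openT.
have -> : local_field (fun p => \sum_a h a p *: Z a p) c =
    fun y => \sum_a local_fun (h a) c y *: local_field (Z a) c y.
  apply/funext => y; rewrite /local_field mulmx_suml.
  by apply: eq_bigr => a _; rewrite -scalemxAl.
by apply: Ck_on_sum => // a _; apply: Ck_onZ => //; [exact: Sh|exact: SZ].
Qed.

End FieldSpan.

(** * Vertical fields as smooth combinations of the fundamental fields *)

Section VerticalFields.
Variables (R : realType) (m : nat) (M : manifold R m).
Variables (Q : M -> {vspace 'M[R]_m}) (P : manifold R (m + 4)) (tau : P -> swann_triple M).
Hypothesis m_gt0 : (0 < m)%N.
Hypothesis Q_aq : almost_quaternionic Q.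
Hypothesis P_swann : is_swann_bundle tau Q.

(** The coefficients [h] come from pointwise choice, which says nothing about smoothness. In a
    trivialization the fibre part of [X] is q times the quaternion with components [h], so [h] is
    q^-1 times that fibre part, a smooth expression. *)
Lemma vertical_field_span : field_span (fundamental_field tau) =
  sections (vertical (swann_proj tau)).
Proof.
have SZ a := @smooth_fundamental_field _ _ _ _ _ _ m_gt0 Q_aq P_swann a.
rewrite -(fundamental_span m_gt0 Q_aq P_swann).
apply/seteqP; split=> X.
  move=> [h Sh ->]; split; first exact: smooth_field_comb.
  by move=> p; exists (h^~ p).
move=> [SX VX]; pose h a p := projT1 (cid (VX p)) a.
have hE p : X p = \sum_a h a p *: fundamental_field tau a p by exact: (projT2 (cid (VX p))).
exists h; last by apply/funext.
move=> a; apply: smooth_fun_local => x _.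
have [s [T [W [g tr]]]] := local_triv_one m_gt0 Q_aq P_swann x.
have oB := triv_open_img tr; set B := _ @` W in oB.
exists x, B; split => //.
- exact: mchart_mem.
- by eexists; [exact: (triv_mem tr)|rewrite /= (triv_center tr)].
move=> j.
have Cg : Ck_on j B g by exact: (triv_smooth_inv tr j).
have CJ : Ck_on j B (fun u => 'J g u) by exact: (smooth_on_jacobian oB (triv_smooth_inv tr)).
have CX : Ck_on j B (local_field X x).
  apply: Ck_on_sub (SX x j) => u /(triv_img tr)[_ Eu _ xT].
  by rewrite -Eu; exact: mem_chart_image.
have Cr : Ck_on j B (fun u => rsubmx (g u) : 'rV[R]_4).
  exact: (Ck_on_mlinear (@rsubmx R 1 m 4) oB Cg).
have CXr : Ck_on j B (fun u => rsubmx (local_field X x u *m 'J g u) : 'rV[R]_4).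
  exact: (Ck_on_mlinear (@rsubmx R 1 m 4) oB (Ck_on_mulmx oB CX CJ)).
have Ci : Ck_on j B (fun u => qinv (rsubmx (g u))).
  by apply: Ck_on_qinv => // u /(triv_img tr)[Wgu _ _ _]; exact: (triv_neq0 tr).
apply: (Ck_on_ext oB _ (Ck_on_coord 0 a oB (Ck_on_qmul oB Ci CXr))) => u fu.
have [Wgu Eu Tu xT] := triv_img tr fu.
rewrite /local_field /local_fun Tu hE (sum_fundamental_field P_swann tr _ Wgu).
have JK := triv_jacobianK tr Wgu; rewrite Eu in JK.
set y := \row_a0 h a0 _.
have E : pad_row m (qmul (rsubmx (g u)) y) *m 'J (cmap (mchart x) \o T) (g u)
    *m coord_frame x (T (g u)) *m coord_coframe x (T (g u)) *m 'J g u =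
    pad_row m (qmul (rsubmx (g u)) y).
  apply: etrans (congr1 (fun A => A *m _) (etrans (esym (mulmxA _ _ _))
    (etrans (congr1 (mulmx _) (coord_frameK xT)) (mulmx1 _)))) _.
  by apply: etrans (esym (mulmxA _ _ _)) (etrans (congr1 (mulmx _) JK) (mulmx1 _)).
rewrite E row_mxKr qmulVK; last exact: (triv_neq0 tr).
by rewrite mxE.
Qed.

End VerticalFields.

Theorem corollary3p8 (R : realType) (n : nat) (n_gt1 : (1 < n)%N)
    (M : manifold R (4 * n)%N) (M_connected : connected [set: M])
    (Q : M -> {vspace 'M[R]_(4 * n)%N}) (omega : M -> 'M[R]_(4 * n)%N)
    (M_qsh : quaternionic_skew_hermitian Q omega)
    (P : manifold R (4 * n + 4)%N) (tau : P -> swann_triple M)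
    (P_swann : is_swann_bundle tau Q) :
  let pi_hat := swann_proj tau in
  let omega_hat := pullback_form2 pi_hat omega in
  let V_hat := vertical pi_hat in
  let Z := fundamental_field tau in
  [/\ basic_form2 tau omega_hat,
      presymplectic omega_hat,
      form2_kernel omega_hat = field_span Z
        /\ form2_kernel omega_hat = sections V_hat,
      distribution_span Z = V_hat &
      integrable_distribution V_hat].
Proof.
move=> pi_hat omega_hat V_hat Z.
(* Positive dimension makes the quaternions act faithfully through a frame. *)
have m_gt0 : (0 < 4 * n)%N by rewrite muln_gt0 /=; exact: ltnW.
have [Q_aq [w2 w_nd _] [nabla [_ tf _ pf]]] := M_qsh.
have Spi : smooth_mapping pi_hat by exact: smooth_swann_proj m_gt0 Q_aq P_swann.
have fpi x : row_full (tangent_map pi_hat x) by exact: row_full_tangent_proj m_gt0 Q_aq P_swann x.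
have aw : forall x u v, form2_eval (omega_hat x) u v = - form2_eval (omega_hat x) v u.
  by move=> x u v; rewrite /omega_hat /pullback_form2 !form2_eval_mul w2.2.
have kerV : form2_kernel omega_hat = sections V_hat.
  apply/seteqP; split=> X [SX HX]; split => // x.
    by apply/(congr_kernel (X x) (fpi x) (w_nd _)) => v; exact: HX.
  move=> v; have /(congr_kernel (X x) (fpi x) (w_nd (pi_hat x))) := HX x; exact.
split.
- split.
  + by split => //; apply: smooth_pullback => //; exact: w2.1.
  + by move=> x v vV u; rewrite /omega_hat /pullback_form2 form2_eval_mul vV
      /form2_eval !mul0mx mxE.
  + move=> q q0; apply/funext => x.
    have Sq := smooth_swann_ract m_gt0 Q_aq P_swann q0.
    (* The action preserves fibres, so by the chain rule the differential of the projection at [x]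
       factors through that of the action. Both sides then evaluate [omega] at the same base
       point. *)
    have E : pi_hat \o swann_ract tau q = pi_hat by apply/funext => y; exact: (proj_ract P_swann).
    have Tc := tangent_map_comp x Sq Spi; rewrite E in Tc.
    rewrite /omega_hat /pullback_form2 [in RHS]Tc trmx_mul !mulmxA.
    by rewrite [pi_hat (swann_ract tau q x)](proj_ract P_swann x q0).
- split; first by apply: closed_pullback => //; exact: (parallel_closed w2 tf pf).
  exists (4 * n)%N => x; apply: rank_congr => //.
  exact: nondegenerate_row_free (w_nd _).
- by split => //; rewrite kerV /Z (vertical_field_span m_gt0 Q_aq P_swann).
- exact: (fundamental_span m_gt0 Q_aq P_swann).
- exact: (integrable_vertical m_gt0 Q_aq P_swann).
Qed.
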